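(* Let $n\in\mathbb N$, $\Omega=[0,1]^n$, let $Y$ be a complex Banach space, let $\lambda\in\mathbb R^n$, and let $\Lambda\subseteq\mathbb R^n$ satisfy $[0,\infty)^n\subseteq\Lambda$, $\Lambda+\Lambda+l\Omega\subseteq\Lambda$ and $\Lambda+l\Omega\subseteq\Lambda$ for all $l>0$. Suppose that $F:\Lambda\to Y$ is Stepanov $(\Omega,1)$-bounded and that the function $F_\lambda(\mathbf t):=e^{-i\langle\lambda,\mathbf t\rangle}F(\mathbf t)$, $\mathbf t\in\Lambda$, belongs to $e-W^1_{ap,\Lambda}(\Lambda:Y)$. Then the Bohr–Fourier coefficient $$P_\lambda(F):=\lim_{T\to+\infty}\frac1{T^n}\int_{\mathbf s+[0,T]^n}e^{-i\langle\lambda,\mathbf t\rangle}F(\mathbf t)\,d\mathbf t$$ exists and does not depend on the choice of $\mathbf s\in[0,\infty)^n$. Moreover, for every $\epsilon>0$ there exists $T_0(\epsilon)>0$ such that for every $T\ge T_0(\epsilon)$ and every $\mathbf s\in[0,\infty)^n$, $$\Biggl\|\frac1{T^n}\int_{[0,T]^n}e^{-i\langle\lambda,\mathbf t\rangle}F(\mathbf t)\,d\mathbf t-\frac1{T^n}\int_{\mathbf s+[0,T]^n}e^{-i\langle\lambda,\mathbf t\rangle}F(\mathbf t)\,d\mathbf t\Biggr\|_Y<\epsilon.$$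
   Context: $\langle\cdot,\cdot\rangle$ is the standard inner product on $\mathbb R^n$; $B(\mathbf t_0,L)$ is the ball of radius $L$ centred at $\mathbf t_0$. $F$ is Stepanov $(\Omega,1)$-bounded if $\sup_{\mathbf t\in\Lambda}\|F(\mathbf t+\cdot)\|_{L^1(\Omega:Y)}<\infty$. $e-W^1_{ap,\Lambda}(\Lambda:Y)$ is the set of all $G:\Lambda\to Y$ such that for every $\epsilon>0$ there exist $l>0$ and $L>0$ such that for each $\mathbf t_0\in\Lambda$ there exists $\tau\in B(\mathbf t_0,L)\cap\Lambda$ with $\sup_{\mathbf t\in\Lambda}l^{-n}\|G(\tau+\cdot)-G(\cdot)\|_{L^1(\mathbf t+l\Omega:Y)}<\epsilon$. *)

(* Defs.v *)
From HB Require Import structures.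
From mathcomp Require Import all_boot all_order all_algebra.
From mathcomp Require Import all_classical all_reals all_analysis.
From mathcomp Require Import complex.
Set Implicit Arguments.
Unset Strict Implicit.
Unset Printing Implicit Defensive.
Import Order.TTheory GRing.Theory Num.Theory.
Import numFieldNormedType.Exports.
Local Open Scope classical_set_scope.
Local Open Scope ring_scope.
Local Open Scope complex_scope.

Definition cbox (R : realType) (n : nat) (a b : 'rV[R]_n) : set 'rV[R]_n :=
  [set x | forall i, a ord0 i <= x ord0 i <= b ord0 i].

Definition boxes (R : realType) (n : nat) : set (set 'rV[R]_n) :=
  [set B | exists a b, B = cbox a b].

Definition Rn (R : realType) (n : nat) := g_sigma_algebraType (@boxes R n).

(* Lebesgue measure on the Borel sets of R^n: a measure giving each
   closed box its volume (this determines it uniquely). *)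
Definition is_lebesgue (R : realType) (n : nat)
    (mu : {measure set (Rn R n) -> \bar R}) : Prop :=
  forall a b : 'rV[R]_n, (forall i, a ord0 i <= b ord0 i) ->
    mu (cbox a b) = (\prod_(i < n) (b ord0 i - a ord0 i))%:E.

Definition cst (R : realType) (n : nat) (c : R) : 'rV[R]_n := const_mx c.

Definition Omega (R : realType) (n : nat) : set 'rV[R]_n := cbox (cst n 0) (cst n 1).
Arguments Omega {R} n.

Definition shift_scale (R : realType) (n : nat) (t : 'rV[R]_n) (l : R)
  (A : set 'rV[R]_n) : set 'rV[R]_n := [set t + l *: x | x in A].

Definition orthant (R : realType) (n : nat) : set 'rV[R]_n :=
  [set x | forall i, 0 <= x ord0 i].
Arguments orthant {R} n.

Definition inner (R : realType) (n : nat) (x y : 'rV[R]_n) : R :=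
  \sum_(i < n) x ord0 i * y ord0 i.
Definition enorm (R : realType) (n : nat) (x : 'rV[R]_n) : R :=
  Num.sqrt (inner x x).
Definition eball (R : realType) (n : nat) (t0 : 'rV[R]_n) (L : R) : set 'rV[R]_n :=
  [set x | enorm (x - t0) < L].

Definition expmi (R : realType) (theta : R) : R[i] :=
  (cos theta)%:C - 'i * (sin theta)%:C.

Section Bochner.
Variables (R : realType) (n : nat) (Y : completeNormedModType R[i]).
Variable mu : {measure set (Rn R n) -> \bar R}.

(* the (real-valued) norm of Y: the norm of a normed R[i]-module is a
   nonnegative element of R[i]; we take its real part *)
Definition ynorm (v : Y) : R := complex.Re `|v|.

Definition sfun_eval (m : nat) (A : 'I_m -> set (Rn R n)) (y : 'I_m -> Y)
  (x : Rn R n) : Y := \sum_(k < m) (if `[< A k x >] then y k else 0).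

Definition sfun_int (m : nat) (A : 'I_m -> set (Rn R n)) (y : 'I_m -> Y) : Y :=
  \sum_(k < m) (fine (mu (A k)))%:C *: y k.

Definition sfun_ok (m : nat) (A : 'I_m -> set (Rn R n)) : Prop :=
  forall k, measurable (A k) /\ (mu (A k) < +oo)%E.

Definition strongly_measurable (D : set (Rn R n)) (f : Rn R n -> Y) : Prop :=
  exists (m : nat -> nat) (A : forall j, 'I_(m j) -> set (Rn R n))
         (y : forall j, 'I_(m j) -> Y),
    (forall j, sfun_ok (A j)) /\
    {ae mu, forall x, D x -> (fun j => sfun_eval (A j) (y j) x) @ \oo --> f x}.

Definition is_bochner (D : set (Rn R n)) (f : Rn R n -> Y) (I : Y) : Prop :=
  measurable D /\ strongly_measurable D f /\
  forall eps : R, 0 < eps ->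
    exists (m : nat) (A : 'I_m -> set (Rn R n)) (y : 'I_m -> Y),
      sfun_ok A /\ (forall k, A k `<=` D) /\
      (\int[mu]_(x in D) (ynorm (f x - sfun_eval A y x))%:E < eps%:E)%E /\
      ynorm (I - sfun_int A y) < eps.

Definition bochner_integrable (D : set (Rn R n)) (f : Rn R n -> Y) : Prop :=
  exists I, is_bochner D f I.

(* the Bochner integral (0 if f is not Bochner integrable on D) *)
Definition bint (D : set (Rn R n)) (f : Rn R n -> Y) : Y :=
  xget 0 [set I | is_bochner D f I].

Definition L1norm (D : set (Rn R n)) (f : Rn R n -> Y) : \bar R :=
  (\int[mu]_(x in D) (ynorm (f x))%:E)%E.

Definition stepanov_bounded (Lambda : set 'rV[R]_n) (F : 'rV[R]_n -> Y) : Prop :=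
  (forall t, Lambda t -> bochner_integrable (Omega n) (fun x => F (t + x)%R)) /\
  exists M : R, forall t, Lambda t ->
    (L1norm (Omega n) (fun x => F (t + x)%R) <= M%:E)%E.

Definition eW1ap (Lambda : set 'rV[R]_n) (G : 'rV[R]_n -> Y) : Prop :=
  forall eps : R, 0 < eps ->
    exists l L : R, 0 < l /\ 0 < L /\
      forall t0, Lambda t0 ->
        exists tau, eball t0 L tau /\ Lambda tau /\
          exists c : R, c < eps /\
            forall t, Lambda t ->
              bochner_integrable (shift_scale t l (Omega n))
                                 (fun x => (G (tau + x) - G x)%R) /\
              ((l ^- n)%:E *
                 L1norm (shift_scale t l (Omega n)) (fun x => (G (tau + x) - G x)%R)
               <= c%:E)%E.

End Bochner.

(* Main.v *)
Require Import Defs.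
From HB Require Import structures.
From mathcomp Require Import all_boot all_order all_algebra.
From mathcomp Require Import all_classical all_reals all_analysis.
From mathcomp Require Import measurable_realfun complex lra.
Import Order.TTheory GRing.Theory Num.Theory.
Import numFieldNormedType.Exports.
Local Open Scope classical_set_scope.
Local Open Scope ring_scope.
Local Open Scope complex_scope.
Set Implicit Arguments.
Unset Strict Implicit.
Unset Printing Implicit Defensive.

(** Let [I(s, T)] be the integral of [G = F_lambda] over [s + [0, T]^n].  An
    [epsilon]-period [tau] within distance [L] of [s] makes
    [I(0, T) - I(tau, T)] at most about [epsilon T^n], by covering [[0, T]^n]
    with cubes of side [l].  The cubes based at [tau] and at [s] are both
    compared with the cube based at [max(tau, s)] (coordinatewise), which keeps
    every point inside [Lambda]; by Stepanov boundedness each comparison costs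
    at most the number of unit cells near the boundary, which is [o(T^n)].
    Hence the means over [s + [0, T]^n] are uniformly close for large [T].
    Since [[0, N T]^n] is tiled by [N^n] cubes of side [T], its mean is then
    close to the mean over [[0, T]^n], and the means form a Cauchy family. *)

(** The value of [\int] at a nonmeasurable function is a lower integral, which is not subadditive,
    while the hypotheses speak of [F] only through such integrals. Errors are therefore bounded by
    integrals of measurable majorants, and integrability is recast as approximability by simple
    functions in that sense; on measurable sets this agrees with [is_bochner]. Integrability of
    [F_lambda] over cubes has to be derived from that of [F], by freezing the character on small
    cells. Completeness of [Y] enters twice: for the existence of integrals and for the limit of the
    means. The measure [mu] is known only through the volumes of boxes, so its translation
    invariance comes from uniqueness of measures. Cubes are closed and neighbouring cells share
    faces, so every tiling identity holds only up to a null set. *)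

(** * The real-valued norm of [Y] and its topology *)

Section Ynorm.
Variables (R : realType) (Y : completeNormedModType R[i]).
Implicit Types (u v w : Y) (c : R[i]) (r : R).

Lemma ynormE v : `|v| = (ynorm v)%:C.
Proof. by rewrite /ynorm RRe_real// normr_real. Qed.

Lemma ynorm_ge0 v : 0 <= ynorm v.
Proof. by rewrite -ler0c -ynormE. Qed.

Lemma ynorm0 : ynorm (0 : Y) = 0.
Proof. by rewrite /ynorm normr0. Qed.

Lemma ynorm_le0 v : ynorm v <= 0 -> v = 0.
Proof.
move=> v0; apply/eqP; rewrite -normr_eq0 ynormE.
by rewrite (le_anti (_ : ynorm v <= 0 <= ynorm v)) ?v0 ?ynorm_ge0.
Qed.

Lemma ynormD u v : ynorm (u + v) <= ynorm u + ynorm v.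
Proof. by have := ler_normD u v; rewrite !ynormE -rmorphD lecR. Qed.

Lemma ynormN v : ynorm (- v) = ynorm v.
Proof. by rewrite /ynorm normrN. Qed.

Lemma ynormB u v : ynorm (u - v) = ynorm (v - u).
Proof. by rewrite -ynormN opprB. Qed.

Lemma ynormB_le w u v : ynorm (u - v) <= ynorm (u - w) + ynorm (w - v).
Proof. by rewrite (le_trans _ (ynormD _ _))// addrA subrK. Qed.

Lemma ynormB_le3 u v w z (a b c : R) : ynorm (u - v) <= a -> ynorm (v - w) <= b ->
  ynorm (w - z) <= c -> ynorm (u - z) <= a + b + c.
Proof.
move=> uv vw wz; rewrite (le_trans (ynormB_le w _ _))// lerD//.
by rewrite (le_trans (ynormB_le v _ _))// lerD.
Qed.

Lemma ynorm_leB u v : ynorm u <= ynorm v + ynorm (u - v).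
Proof. by rewrite (le_trans _ (ynormD _ _))// addrC subrK. Qed.

Lemma ynormZ c v : ynorm (c *: v) = complex.Re `|c| * ynorm v.
Proof.
by apply: complexI; rewrite -ynormE normrZ rmorphM ynormE.
Qed.

Lemma ynormZr r v : ynorm (r%:C *: v) = `|r| * ynorm v.
Proof.
by rewrite ynormZ normc_def/= expr0n addr0 sqrtr_sqr.
Qed.

Lemma ynorm_sum (I : Type) (s : seq I) (P : pred I) (f : I -> Y) :
  ynorm (\sum_(i <- s | P i) f i) <= \sum_(i <- s | P i) ynorm (f i).
Proof.
elim/big_rec2 : _ => [|i y z _ h]; first by rewrite ynorm0.
by rewrite (le_trans (ynormD _ _))// lerD2l.
Qed.

(** A positive element of [R[i]] is real, so the complex radii of the topology of [Y] may be
    replaced by real ones. *)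
Lemma cvg_ynormP (T : Type) (F : set_system T) {FF : Filter F} (f : T -> Y) l :
  f @ F --> l <-> forall e : R, 0 < e -> \forall t \near F, ynorm (l - f t) < e.
Proof.
split=> [/cvgrPdist_lt fl e e0|fl].
  have := fl e%:C; rewrite ltcR => /(_ e0); apply: filterS => t.
  by rewrite ynormE ltcR.
apply/cvgrPdist_lt => e e0.
have eE : e = (complex.Re e)%:C by rewrite RRe_real// gtr0_real.
have : 0 < complex.Re e by rewrite -ltcR -eE.
move=> /fl; apply: filterS => t.
by rewrite eE ynormE ltcR.
Qed.

Lemma ynorm_cauchy_ex (T : Type) (F : set_system T) {FF : ProperFilter F} (f : T -> Y) :
  (forall e : R, 0 < e -> exists l : Y, \forall t \near F, ynorm (l - f t) < e) ->
  exists l : Y, f @ F --> l.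
Proof.
move=> h; have : cauchy_ex (f @ F).
  move=> e e0.
  have eE : e = (complex.Re e)%:C by rewrite RRe_real// gtr0_real.
  have : 0 < complex.Re e by rewrite -ltcR -eE.
  move=> /h [l hl]; exists l; rewrite /fmap/=; apply: filterS hl => t.
  by rewrite -ball_normE/= eE ynormE ltcR.
by move=> /cauchy_exP/cauchy_cvg; exists (lim (f @ F)).
Qed.

End Ynorm.

(** * Upper bounds for integrals of arbitrary nonnegative functions *)

Section UpperIntegral.
Context d (T : measurableType d) (R : realType).
Variable mu : {measure set T -> \bar R}.
Local Open Scope ereal_scope.

(** The integral of a nonnegative function is a supremum over the simple functions below it, and
    those below [f] on [D] lie below [g]; this also covers nonmeasurable [f]. *)
Lemma ge0_le_integral_majorant (f g : T -> \bar R) (D : set T) : measurable D ->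
  (forall x, 0 <= f x) -> (forall x, D x -> f x <= g x) -> 
  (forall x, 0 <= g x) -> 
  \int[mu]_(x in D) f x <= \int[mu]_x g x.
Proof.
move=> mD f0 fg g0.
rewrite integral_mkcond !ge0_integralTE//; last by move=> x; exact: erestrict_ge0.
apply: le_ereal_sup => _ /= [h hf <-]; exists h => // x.
apply: le_trans (hf x) _; rewrite patchE; case: ifPn => // /set_mem; exact: fg.
Qed.

(* An upper integral bound; unlike [\int], whose value at a nonmeasurable
   function is a lower integral, it is subadditive in [f] and in [D]. *)
Definition upper_le (D : set T) (f : T -> R) (c : R) :=
  exists g : T -> \bar R, [/\ measurable_fun setT g, forall x, 0 <= g x,
    forall x, D x -> (f x)%:E <= g x & \int[mu]_x g x <= c%:E].

Lemma upper_leS D D' f f' c c' : upper_le D' f' c' -> D `<=` D' ->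
  (forall x, D x -> (f x <= f' x)%R) -> (c' <= c)%R -> upper_le D f c.
Proof.
move=> [g [mg g0 fg ig]] DD ff cc; exists g; split => //.
  by move=> x Dx; apply: le_trans (fg _ (DD _ Dx)); rewrite lee_fin ff.
by apply: le_trans ig _; rewrite lee_fin.
Qed.

Lemma upper_le_ge0 D f c : upper_le D f c -> (0 <= c)%R.
Proof.
by move=> [g [mg g0 fg ig]]; rewrite -lee_fin (le_trans _ ig)// integral_ge0.
Qed.

Lemma upper_leD D f f' c c' : upper_le D f c -> upper_le D f' c' ->
  upper_le D (f \+ f')%R (c + c').
Proof.
move=> [g [mg g0 fg ig]] [g' [mg' g0' fg' ig']].
exists (fun x => g x + g' x); split.
- exact: emeasurable_funD.
- by move=> x; rewrite adde_ge0.
- by move=> x Dx; rewrite /= EFinD leeD// ?fg ?fg'.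
- by rewrite ge0_integralD// EFinD leeD.
Qed.

Lemma upper_leU D D' f c c' : upper_le D f c -> upper_le D' f c' ->
  upper_le (D `|` D') f (c + c').
Proof.
move=> [g [mg g0 fg ig]] [g' [mg' g0' fg' ig']].
exists (fun x => g x + g' x); split.
- exact: emeasurable_funD.
- by move=> x; rewrite adde_ge0.
- move=> x [Dx|Dx].
    by rewrite (le_trans (fg _ Dx))// leeDl.
  by rewrite (le_trans (fg' _ Dx))// leeDr.
- by rewrite ge0_integralD// EFinD leeD.
Qed.

Lemma upper_le_set0 f : upper_le set0 f 0.
Proof. by exists (cst 0); split=> //; rewrite integral0. Qed.

Lemma upper_le_null N f : measurable N -> mu N = 0 -> upper_le N f 0.
Proof.
(* The majorant is [+oo] on [N], whatever [f] is there; its integral is [+oo * 0 = 0]. *)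
move=> mN N0; exists (fun x => +oo * (\1_N x)%:E); split.
- by apply: emeasurable_funM => //; apply/measurable_EFinP.
- by move=> x; rewrite mule_ge0.
- by move=> x Nx; rewrite indicE mem_set// mule1 leey.
- rewrite ge0_integralZl//; last exact/measurable_EFinP.
  by rewrite integral_indic// setIT N0 mule0.
Qed.

Lemma upper_le_bigcup (I : finType) (P : pred I) (D : I -> set T) f c :
  (forall i, P i -> upper_le (D i) f (c i)) ->
  upper_le [set x | exists2 i, P i & D i x] f (\sum_(i | P i) c i).
Proof.
move=> h; have -> : (\sum_(i | P i) c i = \sum_(i <- enum I | P i) c i)%R.
  by rewrite big_enum_cond.
suff H (s : seq I) : upper_le [set x | exists i, [/\ i \in s, P i & D i x]] f
    (\sum_(i <- s | P i) c i).
  apply: upper_leS (H (enum I)) _ _ _ => // x [j Pj Dj].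
  by exists j; rewrite mem_enum.
elim: s => [|i s ih].
  by rewrite big_nil; apply: upper_leS (upper_le_set0 f) _ _ _ => // x [i []].
rewrite big_cons; case: ifPn => Pi.
  apply: upper_leS (upper_leU (h i Pi) ih) _ _ _ => // x [j []].
  by rewrite inE => /orP[/eqP->|js] Pj Dj; [left|right; exists j].
apply: upper_leS ih _ _ _ => // x [j []]; rewrite inE => /orP[/eqP->|js] Pj Dj.
  by rewrite Pj in Pi.
by exists j.
Qed.

Lemma upper_leZ D f c r : (0 <= r)%R -> upper_le D f c -> upper_le D (fun x => r * f x)%R (r * c).
Proof.
move=> r0 [g [mg g0 fg ig]]; exists (fun x => r%:E * g x); split.
- exact: measurable_funeM.
- by move=> x; rewrite mule_ge0.
- by move=> x Dx; rewrite EFinM lee_wpmul2l// fg.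
- by rewrite ge0_integralZl// EFinM lee_wpmul2l.
Qed.

Lemma integral_le_upper D f c : measurable D -> (forall x, (0 <= f x)%R) ->
  upper_le D f c -> \int[mu]_(x in D) (f x)%:E <= c%:E.
Proof.
move=> mD f0 [g [mg g0 fg ig]]; apply: le_trans ig.
exact: ge0_le_integral_majorant.
Qed.

(** This is the passage from a lower integral to an upper bound. Off a null set [f] is a pointwise
    limit of measurable functions on [D], hence serves there as its own measurable majorant; the
    null set costs nothing. *)
Lemma upper_le_integral (D : set T) (f : T -> R) (h : (T -> R)^nat) c : measurable D ->
  (forall x, (0 <= f x)%R) ->
  (forall j, measurable_fun setT (h j)) ->
  {ae mu, forall x, D x -> h ^~ x @ \oo --> f x} ->
  \int[mu]_(x in D) (f x)%:E <= c%:E -> upper_le D f c.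
Proof.
move=> mD f0 mh [N [mN N0 hN]] intf.
have NP x : D x -> ~ N x -> h ^~ x @ \oo --> f x.
  by move=> Dx Nx; apply: contrapT => hx; apply: Nx; apply: hN => /= /(_ Dx).
pose E := D `\` N.
have mE : measurable E by exact: measurableD.
suff : upper_le E f c.
  move=> /upper_leU /(_ (upper_le_null f mN N0)) U.
  apply: upper_leS U _ _ _ => //; last by rewrite addr0.
  by move=> x Dx; have [Nx|Nx] := pselect (N x); [right|left].
pose g := (EFin \o f) \_ E.
have mg : measurable_fun setT g.
  apply/(measurable_restrictT _ mE).
  apply/measurable_EFinP.
  apply: (@measurable_fun_cvg _ _ _ _ h).
    by move=> m; apply: measurable_funTS.
  by move=> x [Dx Nx]; exact: NP.
exists g; split => //.
- by move=> x; apply: erestrict_ge0 => y _; rewrite lee_fin.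
- by move=> x Ex; rewrite /g patchE mem_set.
- rewrite -integral_mkcond; apply: le_trans intf.
  rewrite (integral_mkcond E) (integral_mkcond D) !ge0_integralTE//.
  + apply: le_ereal_sup => _ /= [k kf <-]; exists k => // x.
    apply: le_trans (kf x) _; rewrite !patchE; case: ifPn => [/set_mem[Dx _]|_].
      by rewrite mem_set.
    by case: ifPn => //; rewrite lee_fin.
  + by move=> x; apply: erestrict_ge0 => y _; rewrite lee_fin.
  + by move=> x; apply: erestrict_ge0 => y _; rewrite lee_fin.
Qed.

End UpperIntegral.


Lemma real_complexD (R : realType) (a b : R) : (a + b)%:C = a%:C + b%:C.
Proof. exact: rmorphD. Qed.

(** * Simple functions and the triangle inequality for their integrals *)

Section SimpleFunctions.
Context d (T : measurableType d) (R : realType) (Y : completeNormedModType R[i]).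
Variable mu : {measure set T -> \bar R}.
Implicit Types (S : seq (set T * Y)) (f g : T -> Y) (I J : Y) (E : set T).

(** Lists of pairs whose sets may overlap make the sum of two simple functions a concatenation. *)
Definition sval_at S x : Y := \sum_(p <- S) (if `[< p.1 x >] then p.2 else 0).

Definition sint S : Y := \sum_(p <- S) (fine (mu p.1))%:C *: p.2.

Definition simple S :=
  forall p, p \in S -> measurable p.1 /\ (mu p.1 < +oo)%E.

Lemma simple_cons p S :
  simple (p :: S) <-> (measurable p.1 /\ (mu p.1 < +oo)%E) /\ simple S.
Proof.
split=> [h|[hp h] q].
  by split=> [|q qS]; apply: h; rewrite inE ?eqxx// qS orbT.
by rewrite inE => /orP[/eqP->//|/h].
Qed.

Lemma simple_cat S S' : simple S -> simple S' -> simple (S ++ S').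
Proof. by move=> h h' p; rewrite mem_cat => /orP[/h|/h']. Qed.

Lemma sval_at_cat S S' x : sval_at (S ++ S') x = sval_at S x + sval_at S' x.
Proof. by rewrite /sval_at big_cat. Qed.

Lemma sint_cat S S' : sint (S ++ S') = sint S + sint S'.
Proof. by rewrite /sint big_cat. Qed.

Definition sscale (c : R[i]) S := [seq (p.1, c *: p.2) | p <- S].

Lemma simple_scale c S : simple S -> simple (sscale c S).
Proof. by move=> h p /mapP[q qS ->]; exact: (h q qS). Qed.

Lemma sval_at_scale c S x : sval_at (sscale c S) x = c *: sval_at S x.
Proof.
rewrite /sval_at big_map scaler_sumr; apply: eq_bigr => p _.
by rewrite /=; case: asboolP => // _; rewrite scaler0.
Qed.

Lemma sint_scale c S : sint (sscale c S) = c *: sint S.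
Proof.
rewrite /sint big_map scaler_sumr; apply: eq_bigr => p _ /=.
by rewrite !scalerA mulrC.
Qed.

Definition srestrict E S := [seq (p.1 `&` E, p.2) | p <- S].

Lemma simple_restrict E S : measurable E -> simple S -> simple (srestrict E S).
Proof.
move=> mE h p /mapP[q /h[mq q_oo] ->] /=; split; first exact: measurableI.
by apply: le_lt_trans q_oo; rewrite le_measure ?inE//; exact: measurableI.
Qed.

(** Extension by zero turns integrals over a set into integrals over the whole space, so that
    integrals over different cubes can be added and subtracted. *)
Definition zext E f x : Y := if `[< E x >] then f x else 0.

Lemma zextT E f x : E x -> zext E f x = f x.
Proof. by move=> Ex; rewrite /zext asboolT. Qed.

Lemma zextF E f x : ~ E x -> zext E f x = 0.
Proof. by move=> Ex; rewrite /zext asboolF. Qed.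

Lemma sval_at_restrict E S x : sval_at (srestrict E S) x = zext E (sval_at S) x.
Proof.
rewrite /sval_at big_map /zext; case: asboolP => Ex.
  apply: eq_bigr => p _ /=; congr (if _ then _ else _).
  by apply: asbool_equiv_eq; split=> [[]|].
by rewrite big1// => p _; rewrite asboolF// => -[].
Qed.

(** The induction peels off one pair and adds its value to the offset [z] on the set [A], so that
    only real-valued functions ever have to be measurable. *)
Lemma measurable_ynorm_sval S z : simple S ->
  measurable_fun setT (fun x => ynorm (z + sval_at S x)).
Proof.
elim: S z => [|[A y] S ih] z; rewrite /sval_at.
  by move=> _; under eq_fun do rewrite big_nil; exact: measurable_cst.
move=> /simple_cons[[/= mA _] sS].
rewrite (_ : (fun _ => _) = fun x => if `[< A x >]
    then ynorm ((z + y) + sval_at S x) else ynorm (z + sval_at S x)); last first.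
  apply/funext => x; rewrite big_cons /=; case: asboolP => _.
    by rewrite addrA.
  by rewrite add0r.
apply: measurable_fun_ifT; [|exact: ih|exact: ih].
apply: (measurable_fun_bool true).
rewrite setTI (_ : _ @^-1` _ = A)//.
by apply/seteqP; split=> x /= => [/asboolP|/asboolP].
Qed.

Lemma measureID_fine A D E : measurable A -> measurable D -> measurable E ->
  (mu D < +oo)%E ->
  fine (mu (A `&` D)) = fine (mu (A `&` (D `&` E))) + fine (mu (A `&` (D `\` E))).
Proof.
move=> mA mD mE Doo.
have fin B : measurable B -> mu (B `&` D) \is a fin_num.
  move=> mB; rewrite ge0_fin_numE//; apply: le_lt_trans Doo.
  by rewrite le_measure ?inE//; exact: measurableI.
rewrite -fineD.
- rewrite -measureU.
  + by rewrite -setIUr setUIDK.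
  + by apply: measurableI => //; exact: measurableI.
  + by apply: measurableI => //; exact: measurableD.
  + by apply/seteqP; split=> x //= [[_ [_ ?]] [_ []]].
- rewrite (_ : A `&` _ = (A `&` E) `&` D); last by rewrite -setIA (setIC E).
  by apply: fin; exact: measurableI.
- rewrite (_ : A `&` _ = (A `\` E) `&` D); last by rewrite !setDE -setIA (setIC (~` E)).
  by apply: fin; exact: measurableD.
Qed.

(** The set [D] is split along the first set [A] of the list: inside [A] the value [y] joins the
    offset [z], outside [A] the pair disappears. The induction thus handles overlapping sets without
    a disjoint refinement. Finiteness of [mu D] makes [fine] additive along the splitting. *)
Lemma ynorm_sint_le_integral S z D (g : T -> \bar R) :
  simple S -> measurable D -> (mu D < +oo)%E ->
  measurable_fun setT g -> (forall x, (0 <= g x)%E) ->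
  (forall x, D x -> ((ynorm (z + sval_at S x))%:E <= g x)%E) ->
  ((ynorm ((fine (mu D))%:C *: z +
     \sum_(p <- S) (fine (mu (p.1 `&` D)))%:C *: p.2))%:E <= \int[mu]_(x in D) g x)%E.
Proof.
elim: S z D => [|[A y] S ih] z D sS mD Doo mg g0 zg.
  rewrite big_nil addr0 ynormZr ger0_norm ?fine_ge0// mulrC EFinM.
  rewrite fineK ?ge0_fin_numE// -integral_cst//.
  apply: ge0_le_integral => //.
  - by move=> x _; rewrite lee_fin ynorm_ge0.
  - exact: measurable_funTS.
  - by move=> x Dx; have := zg _ Dx; rewrite /sval_at big_nil addr0.
move/simple_cons: sS => [[/= mA _] sS].
have mDA : measurable (D `&` A) by exact: measurableI.
have mDB : measurable (D `\` A) by exact: measurableD.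
have ltD B : measurable B -> B `<=` D -> (mu B < +oo)%E.
  by move=> mB BD; apply: le_lt_trans Doo; rewrite le_measure ?inE.
have H1 : (forall x, (D `&` A) x -> ((ynorm ((z + y) + sval_at S x))%:E <= g x)%E).
  by move=> x [Dx Ax]; have := zg _ Dx; rewrite /sval_at big_cons asboolT// addrA.
have H2 : (forall x, (D `\` A) x -> ((ynorm (z + sval_at S x))%:E <= g x)%E).
  by move=> x [Dx Ax]; have := zg _ Dx; rewrite /sval_at big_cons asboolF// add0r.
have {H1} := ih _ _ sS mDA (ltD _ mDA (@subIsetl _ _ _)) mg g0 H1.
have {H2} := ih _ _ sS mDB (ltD _ mDB (@subDsetl _ _ _)) mg g0 H2.
move=> H2 H1; have := leeD H1 H2.
rewrite -ge0_integral_setU//; [|exact: measurable_funTS|]; last first.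
  by rewrite disj_set2E; apply/eqP/seteqP; split=> x //= [[_ ?] []].
rewrite (_ : D `&` A `|` D `\` A = D); last first.
  by apply/seteqP; split=> x; [move=> [[]|[]]|have [|] := pselect (A x); [left|right]].
apply: le_trans; rewrite -EFinD lee_fin; apply: le_trans (ynormD _ _).
rewrite le_eqVlt; apply/orP; left; apply/eqP; congr ynorm; rewrite big_cons/=.
have -> : fine (mu D) = fine (mu (D `&` A)) + fine (mu (D `\` A)).
  by have := @measureID_fine setT D A measurableT mD mA Doo; rewrite !setTI.
under eq_big_seq => p pS.
  have [mp _] := sS p pS; rewrite (measureID_fine mp mD mA Doo) real_complexD scalerDl.
  over.
by rewrite big_split/= real_complexD scalerDl scalerDr (setIC A D) [in X in _ + X]addrA addrACA !addrA.
Qed.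

Lemma simple_bounded S : simple S -> exists D, [/\ measurable D, (mu D < +oo)%E &
  forall p, p \in S -> p.1 `<=` D].
Proof.
elim: S => [|p S ih]; first by exists set0; split=> //; rewrite measure0.
move=> /simple_cons[[mp p_oo] /ih[D [mD Doo SD]]].
exists (p.1 `|` D); split; first exact: measurableU.
  by apply: le_lt_trans (measureU2 _ _ _) _ => //; exact: lte_add_pinfty.
move=> q; rewrite inE => /orP[/eqP->|/SD]; first exact: subsetUl.
by move/subset_trans; apply; exact: subsetUr.
Qed.

Lemma ynorm_sint_le S c : simple S ->
  upper_le mu setT (fun x => ynorm (sval_at S x)) c -> ynorm (sint S) <= c.
Proof.
move=> sS [g [mg g0 Sg ig]]; have [D [mD Doo SD]] := simple_bounded sS.
rewrite -lee_fin; apply: le_trans ig.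
apply: (@le_trans _ _ (\int[mu]_(x in D) g x)%E); last first.
  by apply: ge0_subset_integral.
have := @ynorm_sint_le_integral S 0 D g sS mD Doo mg g0.
rewrite scaler0 add0r /sint.
rewrite (_ : \sum_(p <- S) _ = \sum_(p <- S) (fine (mu p.1))%:C *: p.2).
  by apply=> x Dx; rewrite add0r; apply: Sg.
by apply: eq_big_seq => p pS; rewrite setIidl//; exact: SD.
Qed.

End SimpleFunctions.


(** * The integral defined by approximation with simple functions *)

Section Integral.
Context d (T : measurableType d) (R : realType) (Y : completeNormedModType R[i]).
Variable mu : {measure set T -> \bar R}.
Implicit Types (S : seq (set T * Y)) (f g : T -> Y) (I J : Y) (E : set T).

Local Notation L1_le f c := (upper_le mu setT (fun x => ynorm (f x)) c).

(** The error is measured by a measurable majorant, so measurability of [f] is not a separate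
    clause; strong measurability is recovered in [has_int_simple_ae]. *)
Definition has_int f I := forall e : R, 0 < e -> exists S,
  [/\ simple mu S, L1_le (fun x => f x - sval_at S x) e & ynorm (I - sint mu S) <= e].

Definition L1 f := exists I, has_int f I.

Lemma L1_leD f g c c' : L1_le f c -> L1_le g c' -> L1_le (fun x => f x + g x) (c + c').
Proof.
by move=> hf hg; apply: upper_leS (upper_leD hf hg) _ _ _ => // x _; exact: ynormD.
Qed.

Lemma L1_le_ext f g c : (forall x, f x = g x) -> L1_le f c -> L1_le g c.
Proof. by move=> fg h; apply: upper_leS h _ _ _ => // x _; rewrite fg. Qed.

Lemma L1_leN f c : L1_le f c -> L1_le (fun x => - f x) c.
Proof. by move=> h; apply: upper_leS h _ _ _ => // x _; rewrite ynormN. Qed.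

Lemma L1_leZ (a : R[i]) f c : L1_le f c -> L1_le (fun x => a *: f x) (complex.Re `|a| * c).
Proof.
move=> h; have a0 : 0 <= complex.Re `|a| by rewrite -ler0c RRe_real// normr_real.
by apply: upper_leS (upper_leZ a0 h) _ _ _ => // x _; rewrite ynormZ.
Qed.

Lemma L1_le_zext f D c : upper_le mu D (fun x => ynorm (f x)) c <-> L1_le (zext D f) c.
Proof.
split=> [[g [mg g0 fg ig]]|h]; last first.
  by apply: upper_leS h _ _ _ => // x Dx; rewrite zextT.
exists g; split => // x _; have [Dx|Dx] := pselect (D x).
  by rewrite zextT//; exact: fg.
by rewrite zextF// ynorm0.
Qed.

Lemma ynorm_sintB_le S S' c : simple mu S -> simple mu S' ->
  L1_le (fun x => sval_at S x - sval_at S' x) c -> ynorm (sint mu S - sint mu S') <= c.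
Proof.
move=> sS sS' h.
have := @ynorm_sint_le _ _ _ _ mu (S ++ sscale (-1) S') c.
rewrite sint_cat sint_scale scaleN1r; apply.
  by apply: simple_cat => //; exact: simple_scale.
by apply: L1_le_ext h => x; rewrite sval_at_cat sval_at_scale scaleN1r.
Qed.

Lemma ler_addepsP (x y k : R) : 0 < k -> (forall e, 0 < e -> x <= y + k * e) -> x <= y.
Proof.
move=> k0 h; apply/ler_addgt0Pr => e e0.
by have := h (k^-1 * e); rewrite mulr_gt0 ?invr_gt0// mulrA divff ?gt_eqF// mul1r; apply.
Qed.

Lemma has_int_norm f I c : has_int f I -> L1_le f c -> ynorm I <= c.
Proof.
(* One [e] pays for replacing [f] by a simple function, the other for replacing [I] by its
   integral. *)
move=> hf fc; apply: (@ler_addepsP _ _ 2) => // e /hf[S [sS fS IS]].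
have Sc : L1_le (sval_at S) (c + e).
  apply: L1_le_ext (L1_leD fc (L1_leN fS)) => x.
  by rewrite opprB addrC subrK.
have := ynorm_sint_le sS Sc; have := ynorm_leB I (sint mu S); lra.
Qed.

Lemma has_intD f g I J : has_int f I -> has_int g J -> has_int (fun x => f x + g x) (I + J).
Proof.
move=> hf hg e e0; have e20 : 0 < e / 2 by rewrite divr_gt0.
have [S [sS fS IS]] := hf _ e20; have [S' [sS' gS' JS']] := hg _ e20.
exists (S ++ S'); split; first exact: simple_cat.
  rewrite [e]splitr; apply: L1_le_ext (L1_leD fS gS') => x.
  by rewrite sval_at_cat opprD addrACA.
rewrite sint_cat opprD addrACA; have := ynormD (I - sint mu S) (J - sint mu S').
by lra.
Qed.

Lemma has_intZ (a : R[i]) f I : has_int f I -> has_int (fun x => a *: f x) (a *: I).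
Proof.
move=> hf e e0; set b := complex.Re `|a|.
have b0 : 0 <= b by rewrite -ler0c RRe_real// normr_real.
(* The divisor is [b + 1] because [b] may vanish. *)
have b1 : 0 < b + 1 by lra.
have [|S [sS fS IS]] := hf (e / (b + 1)); first by rewrite divr_gt0.
have be : b * (e / (b + 1)) <= e.
  by rewrite mulrA ler_pdivrMr//; nra.
exists (sscale a S); split; first exact: simple_scale.
- apply: upper_leS (L1_leZ a fS) _ _ _ => // x _.
  by rewrite sval_at_scale scalerBr.
- rewrite sint_scale -scalerBr ynormZ; apply: le_trans be.
  by rewrite ler_wpM2l.
Qed.

Lemma has_int_near f g I : has_int f I -> L1_le (fun x => f x - g x) 0 -> has_int g I.
Proof.
move=> hf fg e /hf[S [sS fS IS]]; exists S; split=> //.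
rewrite -[e]add0r; apply: L1_le_ext (L1_leD (L1_leN fg) fS) => x.
by rewrite opprB addrA subrK.
Qed.

Lemma has_int_ext f g I : (forall x, f x = g x) -> has_int f I -> has_int g I.
Proof. by move=> fg; rewrite (_ : f = g)//; apply/funext. Qed.

Lemma has_intB f g I J : has_int f I -> has_int g J -> has_int (fun x => f x - g x) (I - J).
Proof.
move=> hf /(has_intZ (-1)) hg; rewrite -scaleN1r.
by apply: has_int_ext (has_intD hf hg) => x; rewrite scaleN1r.
Qed.

(** The value of [bint] comes from a choice; uniqueness is what identifies it with a sum of
    integrals over cells. *)
Lemma has_int_uniq f I J : has_int f I -> has_int f J -> I = J.
Proof.
move=> hI hJ; apply/eqP; rewrite -subr_eq0; apply/eqP/ynorm_le0.
apply: has_int_norm (has_intB hI hJ) _.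
apply: L1_le_ext ((L1_le_zext (cst 0) set0 0).1 (upper_le_set0 _ _)) => x.
by rewrite zextF// subrr.
Qed.

Lemma has_int0 : has_int (fun=> 0) 0.
Proof.
move=> e e0; exists [::]; split=> //; last by rewrite /sint big_nil subr0 ynorm0 ltW.
apply: upper_leS ((L1_le_zext (cst 0) set0 0).1 (upper_le_set0 _ _)) _ _ _ => //.
  by move=> x _; rewrite zextF// /sval_at big_nil subr0.
exact: ltW.
Qed.

Lemma has_int_sum (K : Type) (s : seq K) (P : pred K) (f : K -> T -> Y) (I : K -> Y) :
  (forall k, P k -> has_int (f k) (I k)) ->
  has_int (fun x => \sum_(k <- s | P k) f k x) (\sum_(k <- s | P k) I k).
Proof.
move=> h; elim: s => [|k s ih].
  by rewrite big_nil; apply: has_int_ext has_int0 => x; rewrite big_nil.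
rewrite big_cons; case: ifP => Pk.
  by apply: has_int_ext (has_intD (h _ Pk) ih) => x; rewrite big_cons Pk.
by apply: has_int_ext ih => x; rewrite big_cons Pk.
Qed.

(* Completeness of [Y] turns L1-approximability into integrability. *)
Lemma L1_simple_approx f : (forall e : R, 0 < e -> exists S, simple mu S /\
  L1_le (fun x => f x - sval_at S x) e) -> L1 f.
Proof.
move=> h; pose e n : R := n.+1%:R^-1.
have e0 n : 0 < e n by rewrite invr_gt0.
have [S hS] : {S : nat -> seq (set T * Y) & forall n, simple mu (S n) /\
    L1_le (fun x => f x - sval_at (S n) x) (e n)}.
  apply: (@choice _ _ (fun n S => simple mu S /\
    L1_le (fun x => f x - sval_at S x) (e n))) => n; exact: h.
have SS n m : ynorm (sint mu (S n) - sint mu (S m)) <= e n + e m.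
  have [sn fn] := hS n; have [sm fm] := hS m.
  apply: ynorm_sintB_le => //; apply: L1_le_ext (L1_leD (L1_leN fn) fm) => x.
  by rewrite opprB addrA subrK.
have elt r : 0 < r -> \forall n \near \oo, e n < r.
  by move=> r0; exact: near_infty_natSinv_lt (PosNum r0).
have [I hI] : exists I, (fun n => sint mu (S n)) @ \oo --> I.
  apply: ynorm_cauchy_ex => r r0.
  have r20 : 0 < r / 2 by rewrite divr_gt0.
  have [N _ HN] := elt _ r20; exists (sint mu (S N)); near=> n.
  apply: le_lt_trans (SS _ _) _; rewrite [r]splitr ltrD//; first exact: (HN N (leqnn N)).
  by near: n; exact: elt.
exists I => r r0.
have r20 : 0 < r / 2 by rewrite divr_gt0.
have [N _ HN] := elt _ r20.
have [N' _ HN'] := (cvg_ynormP _ _).1 hI _ r0.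
pose n := maxn N N'; exists (S n).
have [sn fn] := hS n; split=> //.
  apply: upper_leS fn _ _ _ => //; apply: ltW.
  by have := HN n (leq_maxl _ _); lra.
by apply: ltW; apply: HN' (leq_maxr _ _).
Unshelve. all: by end_near. Qed.

Lemma L1_approx f : (forall e : R, 0 < e -> exists g, L1 g /\
  L1_le (fun x => f x - g x) e) -> L1 f.
Proof.
move=> h; apply: L1_simple_approx => e e0.
have e20 : 0 < e / 2 by rewrite divr_gt0.
have [g [[I hg] fg]] := h _ e20; have [S [sS gS _]] := hg _ e20.
exists S; split=> //; rewrite [e]splitr; apply: L1_le_ext (L1_leD fg gS) => x.
by rewrite addrA subrK.
Qed.

Lemma L1_zext E f : measurable E -> L1 f -> L1 (zext E f).
Proof.
move=> mE [I hf]; apply: L1_simple_approx => e /hf[S [sS fS _]].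
exists (srestrict E S); split; first exact: simple_restrict.
apply: upper_leS fS _ _ _ => // x _; rewrite sval_at_restrict.
have [Ex|Ex] := pselect (E x); first by rewrite !zextT.
by rewrite !zextF// subrr ynorm0 ynorm_ge0.
Qed.

Lemma L1_zextS D E f : measurable D -> D `<=` E -> L1 (zext E f) -> L1 (zext D f).
Proof.
move=> mD DE /(L1_zext mD)[I hI]; exists I; apply: has_int_ext hI => x.
have [Dx|Dx] := pselect (D x); last by rewrite !zextF.
by rewrite !zextT//; exact: DE.
Qed.

(* Simple approximants with errors [2^-(j+1)] converge almost everywhere: the sum
   of the majorants of the errors has a finite integral. *)
Lemma has_int_simple_ae f I : has_int f I ->
  exists S : nat -> seq (set T * Y), (forall j, simple mu (S j)) /\
    {ae mu, forall x, (fun j => sval_at (S j) x) @ \oo --> f x}.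
Proof.
move=> hf; pose e j : R := 1 / (2 ^ (j + 1))%:R.
have e0 j : 0 < e j by rewrite divr_gt0// ltr0n expn_gt0.
pose P j (p : seq (set T * Y) * (T -> \bar R)) := simple mu p.1 /\
   [/\ measurable_fun setT p.2, forall x, (0 <= p.2 x)%E,
   forall x, ((ynorm (f x - sval_at p.1 x))%:E <= p.2 x)%E &
   (\int[mu]_x p.2 x <= (e j)%:E)%E].
have [p hp] : {p & forall j, P j (p j)}.
  apply: choice => j; have [S [sS [g [mg g0 fg ig]] _]] := hf _ (e0 j).
  by exists (S, g); split => //; split=> // x; exact: fg.
exists (fun j => (p j).1); split; first by move=> j; case: (hp j).
pose G x := (\sum_(0 <= j <oo) (p j).2 x)%E.
have mp j : measurable_fun setT (p j).2 by case: (hp j) => _ [].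
have p0 j x : (0 <= (p j).2 x)%E by case: (hp j) => _ [].
have mG : measurable_fun setT G.
  by apply: ge0_emeasurable_sum => //.
have G0 x : (0 <= G x)%E by exact: nneseries_ge0.
have IG : (\int[mu]_x G x < +oo)%E.
  rewrite integral_nneseries//.
  apply: (@le_lt_trans _ _ (\sum_(0 <= j <oo) (e j)%:E)%E).
    by apply: lee_nneseries => // [j _ _|j _]; [exact: integral_ge0|case: (hp j) => _ []].
  rewrite (cvg_lim _ (@cvg_geometric_eseries_half R 1 0))// expr0 divr1.
  exact: ltry.
have /integrable_ae : mu.-integrable setT G.
  apply/integrableP; split=> //; rewrite (_ : (\int[mu]_x _)%E = \int[mu]_x G x)%E//.
  by apply: eq_integral => x _; rewrite gee0_abs.
move=> /(_ measurableT); apply: filterS => x /(_ Logic.I).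
rewrite ge0_fin_numE// => Gx.
have pfin j : (p j).2 x \is a fin_num.
  rewrite ge0_fin_numE//; apply: le_lt_trans Gx.
  apply: (@le_trans _ _ (\sum_(0 <= k < j.+1) (p k).2 x)%E); last first.
    by apply: nneseries_lim_ge.
  by rewrite big_nat_recr//= leeDr// sume_ge0.
pose u j := fine ((p j).2 x).
have u0 j : 0 <= u j by exact: fine_ge0.
have : cvgn (series u).
  apply: nondecreasing_is_cvgn.
    by apply/nondecreasing_seqP => j; rewrite /series/= big_nat_recr//= lerDl.
  exists (fine (G x)) => _ [j _ <-]; rewrite -lee_fin fineK; last first.
    by rewrite ge0_fin_numE.
  rewrite /series/= -sumEFin.
  apply: le_trans (@nneseries_lim_ge _ (fun j => (p j).2 x) xpredT 0%N j _) => //.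
  by apply: lee_sum => k _; rewrite /u fineK.
move=> /cvg_series_cvg_0/cvgr0Pnorm_lt u_0.
apply/cvg_ynormP => r /u_0; apply: filterS => j; apply: le_lt_trans.
rewrite ger0_norm// -lee_fin /u fineK//.
by case: (hp j) => _ [_ _ hh _]; apply: hh.
Qed.

End Integral.


(** * Change of variables under a measure-preserving map *)

Section MeasurePreserving.
Context d (T : measurableType d) (R : realType) (Y : completeNormedModType R[i]).
Variable mu : {measure set T -> \bar R}.
Variable phi : T -> T.
Hypothesis mphi : measurable_fun setT phi.
Hypothesis mu_phi : forall A, measurable A -> mu (phi @^-1` A) = mu A.

Lemma upper_le_comp D (f : T -> R) c :
  upper_le mu D f c -> upper_le mu (phi @^-1` D) (f \o phi) c.
Proof.
move=> [g [mg g0 fg ig]]; exists (g \o phi); split.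
- exact: measurableT_comp.
- by move=> x; exact: g0.
- by move=> x; exact: fg.
- rewrite -(preimage_setT phi) -ge0_integral_pushforward//.
  by rewrite (eq_measure_integral mu)// => A mA _; exact: mu_phi.
Qed.

Lemma has_int_comp (f : T -> Y) I : has_int mu f I -> has_int mu (f \o phi) I.
Proof.
move=> hf e /hf[S [sS fS IS]].
exists [seq (phi @^-1` p.1, p.2) | p <- S]; split.
- move=> p /mapP[q /sS[mq q_oo] ->]; split; last by rewrite /= mu_phi.
  by rewrite -[X in measurable X]setTI; exact: mphi.
- have := upper_le_comp fS; rewrite preimage_setT => U.
  by apply: upper_leS U _ _ _ => // x _; rewrite /= /sval_at big_map.
- suff -> : sint mu [seq (phi @^-1` p.1, p.2) | p <- S] = sint mu S by [].
  rewrite /sint big_map; apply: eq_big_seq => p /sS[mp _] /=.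
  by rewrite mu_phi.
Qed.

End MeasurePreserving.

(** * Equivalence with the Bochner integral *)

Section Bochner.
Variables (R : realType) (n : nat) (Y : completeNormedModType R[i]).
Variable mu : {measure set (Rn R n) -> \bar R}.
Implicit Types (D : set (Rn R n)) (f : Rn R n -> Y) (I : Y).

Definition seq_of_sfun m (A : 'I_m -> set (Rn R n)) (y : 'I_m -> Y) :=
  [seq (A k, y k) | k <- enum 'I_m].

Lemma sval_at_sfun m (A : 'I_m -> set (Rn R n)) (y : 'I_m -> Y) x :
  sval_at (seq_of_sfun A y) x = sfun_eval A y x.
Proof. by rewrite /sval_at big_map big_enum. Qed.

Lemma sint_sfun m (A : 'I_m -> set (Rn R n)) (y : 'I_m -> Y) :
  sint mu (seq_of_sfun A y) = sfun_int mu A y.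
Proof. by rewrite /sint big_map big_enum. Qed.

Lemma simple_sfun m (A : 'I_m -> set (Rn R n)) (y : 'I_m -> Y) :
  sfun_ok mu A -> simple mu (seq_of_sfun A y).
Proof. by move=> h p /mapP[k _ ->]; exact: (h k). Qed.

Lemma simple_sfunP S : simple mu S ->
  exists (m : nat) (A : 'I_m -> set (Rn R n)) (y : 'I_m -> Y),
  [/\ sfun_ok mu A, sfun_int mu A y = sint mu S,
   forall x, sfun_eval A y x = sval_at S x &
   forall k, exists2 p, p \in S & A k = p.1].
Proof.
move=> sS; exists (size S), (fun k => (nth (set0, 0) S k).1),
   (fun k => (nth (set0, 0) S k).2).
split.
- by move=> k; exact: (sS _ (mem_nth _ (ltn_ord k))).
- by rewrite /sint (big_nth (set0, 0)) big_mkord.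
- by move=> x; rewrite /sval_at (big_nth (set0, 0)) big_mkord.
- by move=> k; exists (nth (set0, 0) S k); rewrite ?mem_nth.
Qed.

(** The norms of the simple approximants are measurable and converge almost everywhere on [D] to the
    norm of [f], so the lower integral already yields a majorant. *)
Lemma upper_le_strongly_measurable D f c : measurable D ->
  strongly_measurable mu D f ->
  (\int[mu]_(x in D) (ynorm (f x))%:E <= c%:E)%E ->
  upper_le mu D (fun x => ynorm (f x)) c.
Proof.
move=> mD [m [A [y [sA Af]]]].
apply: (@upper_le_integral _ _ _ _ _ _
    (fun j x => ynorm (sval_at (seq_of_sfun (A j) (y j)) x))) => //.
- by move=> x; exact: ynorm_ge0.
- move=> j; have := @measurable_ynorm_sval _ _ _ _ mu (seq_of_sfun (A j) (y j)) 0.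
  move=> /(_ (@simple_sfun _ _ (y j) (sA j))); apply: eq_measurable_fun => x _.
  by rewrite add0r.
- apply: filterS Af => x h Dx; have /cvg_ynormP {}h := h Dx.
  apply/cvgrPdist_lt => e /h; apply: filterS => j.
  rewrite sval_at_sfun; apply: le_lt_trans.
  rewrite ler_norml; have := ynorm_leB (f x) (sfun_eval (A j) (y j) x).
  have := ynorm_leB (sfun_eval (A j) (y j) x) (f x).
  by rewrite (ynormB _ (f x)); lra.
Qed.

Lemma strongly_measurableB D f S : simple mu S -> strongly_measurable mu D f ->
  strongly_measurable mu D (fun x => f x - sval_at S x).
Proof.
move=> sS [m [A [y [sA Af]]]].
pose S' j := seq_of_sfun (A j) (y j) ++ sscale (-1) S.
have sS' j : simple mu (S' j).
  by apply: simple_cat; [exact: simple_sfun|exact: simple_scale].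
exists (fun j => size (S' j)), (fun j k => (nth (set0, 0) (S' j) k).1),
   (fun j k => (nth (set0, 0) (S' j) k).2); split.
- by move=> j k; exact: (sS' j _ (mem_nth _ (ltn_ord k))).
- apply: filterS Af => x h Dx.
  rewrite (_ : (fun _ => _) = fun j => sfun_eval (A j) (y j) x - sval_at S x).
    by apply: cvgB; [exact: h|exact: cvg_cst].
  apply/funext => j; rewrite -(sval_at_sfun (A j)) -scaleN1r -sval_at_scale -sval_at_cat.
  by rewrite /sval_at -/(S' j) (big_nth (set0, 0)) big_mkord.
Qed.

(** The error [f - S] is strongly measurable on [D], so its integral bound upgrades to a majorant.
    Outside [D] both terms vanish because the sets of [S] lie in [D]. *)
Lemma is_bochner_has_int D f I : is_bochner mu D f I -> has_int mu (zext D f) I.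
Proof.
move=> [mD [smf h]] e e0; have [m [A [y [sA [AD [fA IA]]]]]] := h _ e0.
have sS := @simple_sfun _ _ y sA.
exists (seq_of_sfun A y); split => //; last by rewrite sint_sfun ltW.
have : upper_le mu D (fun x => ynorm (f x - sval_at (seq_of_sfun A y) x)) e.
  apply: upper_le_strongly_measurable => //; first exact: strongly_measurableB.
  by apply: ltW; under eq_integral do rewrite sval_at_sfun.
move/L1_le_zext; apply: L1_le_ext => x.
have [Dx|Dx] := pselect (D x); first by rewrite !zextT.
rewrite !zextF// sval_at_sfun /sfun_eval big1 ?subr0// => k _.
by rewrite asboolF// => /AD.
Qed.

Lemma has_int_is_bochner D f I : measurable D -> has_int mu (zext D f) I ->
  is_bochner mu D f I.
Proof.
move=> mD hf; split=> //; split.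
  have [S [sS /= Sf]] := has_int_simple_ae hf.
  exists (fun j => size (S j)), (fun j k => (nth (set0, 0) (S j) k).1),
     (fun j k => (nth (set0, 0) (S j) k).2); split.
  - by move=> j k; exact: (sS j _ (mem_nth _ (ltn_ord k))).
  - apply: filterS Sf => x h Dx; rewrite zextT// in h.
    rewrite (_ : (fun _ => _) = fun j => sval_at (S j) x)//.
    by apply/funext => j; rewrite /sval_at (big_nth (set0, 0)) big_mkord.
(* Two errors add up in the estimate of [I]; [e / 4] rather than [e / 2] leaves room for the strict
   inequalities of [is_bochner]. *)
move=> e e0; have e40 : 0 < e / 4 by rewrite divr_gt0.
have [S [sS fS IS]] := hf _ e40.
have sSD := simple_restrict mD sS.
have [m [A [y [sA iA eA AS]]]] := simple_sfunP sSD.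
exists m, A, y; split=> //; split; [|split].
- by move=> k; have [p /mapP[q _ ->] ->] := AS k; exact: subIsetr.
- apply: (@le_lt_trans _ _ (e / 4)%:E); last by rewrite lte_fin; lra.
  apply: integral_le_upper => //; first by move=> x; exact: ynorm_ge0.
  apply: upper_leS fS _ _ _ => // x Dx.
  by rewrite eA sval_at_restrict !zextT.
(* Off [D] the function [zext D f] is zero, so the part of [S] removed by the restriction is itself
   approximation error. *)
- rewrite iA; have : ynorm (sint mu S - sint mu (srestrict D S)) <= e / 4.
    apply: ynorm_sintB_le => //; apply: upper_leS fS _ _ _ => // x _.
    rewrite sval_at_restrict; have [Dx|Dx] := pselect (D x).
      by rewrite !zextT// subrr ynorm0 ynorm_ge0.
    by rewrite !zextF// subr0 sub0r ynormN.
  by have := ynormB_le (sint mu S) I (sint mu (srestrict D S)); lra.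
Qed.

Lemma bint_has_int D f : measurable D -> L1 mu (zext D f) ->
  has_int mu (zext D f) (bint mu D f).
Proof.
move=> mD [I hI]; apply: is_bochner_has_int.
rewrite /bint; have : [set I | is_bochner mu D f I] I by exact: has_int_is_bochner.
exact: xgetI.
Qed.

Lemma upper_le_L1norm D f c : bochner_integrable mu D f ->
  (L1norm mu D f <= c%:E)%E -> upper_le mu D (fun x => ynorm (f x)) c.
Proof. by move=> [I [mD [smf _]]]; exact: upper_le_strongly_measurable. Qed.

End Bochner.

(** * Boxes and translation invariance of Lebesgue measure *)

Section Lebesgue.
Variables (R : realType) (n : nat) (mu : {measure set (Rn R n) -> \bar R}).
Hypothesis Hmu : is_lebesgue mu.
Implicit Types a b t : 'rV[R]_n.

Lemma measurable_cbox a b : measurable (cbox a b : set (Rn R n)).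
Proof. by apply: sub_sigma_algebra; exists a, b. Qed.

Lemma cboxI a b a' b' : cbox a b `&` cbox a' b' =
  cbox (\row_i Num.max (a ord0 i) (a' ord0 i)) (\row_i Num.min (b ord0 i) (b' ord0 i)).
Proof.
apply/seteqP; split=> x /=.
  move=> [h h'] i; rewrite !mxE ge_max le_min.
  by move: (h i) (h' i) => /andP[-> ->] /andP[-> ->].
move=> h; split=> i; move: (h i); rewrite !mxE ge_max le_min.
  by move=> /andP[/andP[-> _] /andP[-> _]].
by move=> /andP[/andP[_ ->] /andP[_ ->]].
Qed.

Lemma cbox_set0 a b i : b ord0 i < a ord0 i -> cbox a b = set0.
Proof.
move=> ba; apply/seteqP; split=> x //= /(_ i) /andP[ax xb].
by have := lt_le_trans ba (le_trans ax xb); rewrite ltxx.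
Qed.

Lemma lebesgue_cbox_lty a b : (mu (cbox a b) < +oo)%E.
Proof.
have [h|/existsNP[i /negP]] := pselect (forall i, a ord0 i <= b ord0 i).
  by rewrite Hmu// ltry.
by rewrite -ltNge => /cbox_set0 ->; rewrite measure0.
Qed.

Lemma lebesgue_cbox0 a b i : b ord0 i <= a ord0 i -> mu (cbox a b) = 0%E.
Proof.
move=> ba; have [h|/existsNP[j /negP]] := pselect (forall i, a ord0 i <= b ord0 i).
  rewrite Hmu// (bigD1 i)//= (_ : b ord0 i - a ord0 i = 0) ?mul0r//.
  by apply/eqP; rewrite subr_eq0 eq_le ba h.
by rewrite -ltNge => /cbox_set0 ->; rewrite measure0.
Qed.

Lemma preimage_shift_cbox t a b :
  (fun x => t + x) @^-1` cbox a b = cbox (a - t) (b - t).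
Proof.
apply/seteqP; split=> x /= h i; have := h i; rewrite !mxE; lra.
Qed.

Lemma measurable_shift t :
  measurable_fun setT ((fun x => t + x) : Rn R n -> Rn R n).
Proof.
apply: measurability => //.
move=> _ [_ [a [b ->]] <-]; rewrite setTI preimage_shift_cbox.
exact: measurable_cbox.
Qed.

(** Boxes are stable under intersection and generate the sigma-algebra, and the boxes [[-k, k]^n]
    have finite measure and exhaust the space. Since [mu] and its image under the translation agree
    on boxes, they coincide. *)
Lemma lebesgue_shift t (A : set (Rn R n)) : measurable A ->
  mu ((fun x => t + x) @^-1` A) = mu A.
Proof.
move=> mA.
have mt := measurable_shift t.
pose nu : {measure set (Rn R n) -> \bar R} :=
  measure_function_pushforward__canonical__measure_function_Measure mu mt.
suff : nu A = mu A by [].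
apply: (@measure_unique _ R (Rn R n) (@boxes R n)
  (fun k => cbox (const_mx (- k%:R)) (const_mx k%:R))) => //.
- by move=> _ _ [a [b ->]] [a' [b' ->]]; rewrite cboxI; do 2 eexists.
- by move=> k; do 2 eexists.
- apply/seteqP; split=> x // _.
  have [k hk] : exists k : nat, forall i, `|x ord0 i| <= k%:R.
    exists (\sum_i (Num.bound `|x ord0 i|%R))%N => i.
    apply: le_trans (ltW (archi_boundP (normr_ge0 _))) _.
    by rewrite ler_nat (bigD1 i)//= leq_addr.
  by exists k => // i; rewrite !mxE; have := hk i; rewrite ler_norml.
- move=> _ [a [b ->]]; rewrite /nu/= /pushforward preimage_shift_cbox.
  have [h|/existsNP[i /negP]] := pselect (forall i, a ord0 i <= b ord0 i).
    rewrite !Hmu//; last by move=> i; rewrite !mxE lerD2r.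
    by congr (_%:E); apply: eq_bigr => i _; rewrite !mxE; lra.
  rewrite -ltNge => ba; rewrite (cbox_set0 ba) (@cbox_set0 _ _ i)//.
  by rewrite !mxE ltrD2r.
- by move=> k; rewrite /nu/= /pushforward preimage_shift_cbox lebesgue_cbox_lty.
Qed.

End Lebesgue.


(** * Cubes, grids and counting of cells *)

Section Grid.
Variables (R : realType) (n : nat) (Y : completeNormedModType R[i]).
Variable mu : {measure set (Rn R n) -> \bar R}.
Hypothesis Hmu : is_lebesgue mu.
Implicit Types (a t : 'rV[R]_n) (f : Rn R n -> Y) (phi : Rn R n -> R) (D : set (Rn R n)).

Definition cube a (l : R) : set (Rn R n) := cbox a (\row_i (a ord0 i + l)).

Lemma cubeP a l x :
  cube a l x <-> forall i, a ord0 i <= x ord0 i <= a ord0 i + l.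
Proof. by split=> h i; have := h i; rewrite mxE. Qed.

Lemma measurable_cube a l : measurable (cube a l : set (Rn R n)).
Proof. exact: measurable_cbox. Qed.

Lemma shift_scale_Omega a l : 0 < l -> shift_scale a l (Omega n) = cube a l.
Proof.
move=> l0; apply/seteqP; split=> x.
  move=> [y hy <-]; apply/cubeP => i; have := hy i; rewrite !mxE; nra.
move=> /cubeP h; exists (l^-1 *: (x - a)).
  move=> i; have := h i; rewrite !mxE => /andP[h1 h2].
  rewrite mulr_ge0 ?invr_ge0 ?subr_ge0 ?(ltW l0)//=.
  by rewrite mulrC ler_pdivrMr// mul1r lerBlDl.
by rewrite scalerA divff ?gt_eqF// scale1r addrC subrK.
Qed.

Lemma Omega_cube : Omega n = cube 0 1 :> set 'rV[R]_n.
Proof.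
by apply/seteqP; split=> x h i; have := h i; rewrite !mxE add0r.
Qed.

Lemma preimage_shift_cube t a l :
  (fun x => t + x) @^-1` cube (t + a) l = cube a l.
Proof.
by apply/seteqP; split=> x /cubeP h; apply/cubeP => i; have := h i; rewrite !mxE; lra.
Qed.

Definition grid_point a (h : R) (N : nat) (k : {ffun 'I_n -> 'I_N}) : 'rV[R]_n :=
  \row_i (a ord0 i + (k i)%:R * h).

Lemma grid_cell_ex (h y : R) N : 0 < h -> 0 <= y <= N.+1%:R * h ->
  exists k : 'I_N.+1, k%:R * h <= y <= k%:R * h + h.
Proof.
move=> h0; elim: N => [|N ih] /andP[y0 yN].
  by exists ord0; rewrite mul0r add0r y0/= -[h]mul1r.
have [yN1|yN1] := leP y (N.+1%:R * h).
  have [|k hk] := ih; first by rewrite y0.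
  by exists (widen_ord (leqnSn _) k).
by exists ord_max; rewrite (ltW yN1)/= (le_trans yN)// -[in leLHS]natr1 mulrDl mul1r.
Qed.

Lemma grid_cover a h N x : 0 < h -> (0 < N)%N -> cube a (N%:R * h) x ->
  exists k : {ffun 'I_n -> 'I_N}, cube (grid_point a h k) h x.
Proof.
move=> h0; case: N => // N _ /cubeP hx.
have /fin_all_exists[k hk] i : exists k : 'I_N.+1,
    k%:R * h <= x ord0 i - a ord0 i <= k%:R * h + h.
  by apply: grid_cell_ex => //; have := hx i; lra.
exists [ffun i => k i]; apply/cubeP => i; have := hk i; rewrite !mxE ffunE; lra.
Qed.

Lemma grid_sub a h N (k : {ffun 'I_n -> 'I_N}) : 0 < h ->
  cube (grid_point a h k) h `<=` cube a (N%:R * h).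
Proof.
move=> h0 x /cubeP hx; apply/cubeP => i; have := hx i; rewrite !mxE.
have k0 : 0 <= (k i)%:R * h by rewrite mulr_ge0// ltW.
have kN : (k i)%:R * h + h <= N%:R * h.
  by rewrite -[X in _ + X]mul1r -mulrDl natr1 ler_wpM2r ?ler_nat// ltW.
by move=> /andP[h1 h2]; apply/andP; split; lra.
Qed.

(** The indices differ in some coordinate, and in that coordinate the intersection has no width. *)
Lemma grid_null a h N (k k' : {ffun 'I_n -> 'I_N}) : 0 < h -> k != k' ->
  mu (cube (grid_point a h k) h `&` cube (grid_point a h k') h) = 0%E.
Proof.
move=> h0 kk'; have [i ki] : exists i, k i != k' i.
  apply/existsP; apply: contraNT kk'; rewrite negb_exists => /forallP kk'.
  by apply/eqP/ffunP => i; apply/eqP; have := kk' i; rewrite negbK.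
rewrite /cube cboxI; apply: (lebesgue_cbox0 Hmu (i := i)); rewrite !mxE.
have step (u v : 'I_N) : (u < v)%N -> u%:R * h + h <= v%:R * h :> R.
  by move=> uv; rewrite -[X in _ + X]mul1r -mulrDl natr1 ler_wpM2r ?ler_nat// ltW.
rewrite ge_min !le_max; move: ki; rewrite neq_ltn => /orP[/step|/step] hk.
  by apply/orP; left; apply/orP; right; lra.
by apply/orP; right; apply/orP; left; lra.
Qed.

Lemma upper_le_grid a h N phi c (P : pred {ffun 'I_n -> 'I_N}) :
  (forall k, P k -> upper_le mu (cube (grid_point a h k) h) phi c) ->
  upper_le mu [set x | exists2 k, P k & cube (grid_point a h k) h x] phi (#|P|%:R * c).
Proof.
by move=> H; have := upper_le_bigcup H; rewrite sumr_const mulr_natl.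
Qed.

Lemma upper_le_cube a h N phi c : 0 < h -> (0 < N)%N ->
  (forall k : {ffun 'I_n -> 'I_N}, upper_le mu (cube (grid_point a h k) h) phi c) ->
  upper_le mu (cube a (N%:R * h)) phi ((N ^ n)%:R * c).
Proof.
move=> h0 N0 H; apply: upper_leS (@upper_le_grid a h N phi c predT _) _ _ _ => //.
- by move=> x /(grid_cover h0 N0)[k hk]; exists k.
- by rewrite card_ffun !card_ord.
Qed.

(** Closed cells overlap in faces only, which make up the null set [Z]. Off [Z], a point of the
    large cube lies in exactly one cell and any other point in none, so the difference vanishes
    there. *)
Lemma grid_zext a h N f : 0 < h -> (0 < N)%N ->
  upper_le mu setT (fun x => ynorm ((\sum_(k : {ffun 'I_n -> 'I_N})
    zext (cube (grid_point a h k) h) f x) - zext (cube a (N%:R * h)) f x)) 0.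
Proof.
move=> h0 N0; pose C (k : {ffun 'I_n -> 'I_N}) := cube (grid_point a h k) h.
pose K := {ffun 'I_n -> 'I_N}.
pose Z := [set x | exists2 p : K * K, p.1 != p.2 & (C p.1 `&` C p.2) x].
pose u x := \sum_(k : K) zext (C k) f x - zext (cube a (N%:R * h)) f x.
have := @upper_le_bigcup _ _ _ mu _ (fun p : K * K => p.1 != p.2)
  (fun p => C p.1 `&` C p.2) (fun x => ynorm (u x)) (fun=> 0).
rewrite big1// => H; have {H} : upper_le mu Z (fun x => ynorm (u x)) 0.
  apply: H => -[k k'] kk'; apply: upper_le_null; last exact: grid_null.
  by apply: measurableI; exact: measurable_cube.
move=> [g [mg g0 ug ig]]; exists g; split=> // x _.
have [Zx|Zx] := pselect (Z x); first exact: ug.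
suff -> : \sum_(k : K) zext (C k) f x - zext (cube a (N%:R * h)) f x = 0.
  by rewrite ynorm0.
have [Qx|Qx] := pselect (cube a (N%:R * h) x).
  have [k kx] := grid_cover h0 N0 Qx.
  rewrite (bigD1 k)//= big1 => [|k' k'k]; first by rewrite !zextT// addr0 subrr.
  by rewrite zextF// => k'x; apply: Zx; exists (k', k).
rewrite (zextF _ Qx) subr0 big1// => k _; rewrite zextF// => /(grid_sub h0).
exact: Qx.
Qed.

Lemma has_int_grid a h N f (J : {ffun 'I_n -> 'I_N} -> Y) : 0 < h -> (0 < N)%N ->
  (forall k, has_int mu (zext (cube (grid_point a h k) h) f) (J k)) ->
  has_int mu (zext (cube a (N%:R * h)) f) (\sum_k J k).
Proof.
move=> h0 N0 H; apply: has_int_near (grid_zext _ _ h0 N0).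
by apply: has_int_sum => k _; exact: H.
Qed.

Lemma L1_grid a h N f : 0 < h -> (0 < N)%N ->
  (forall k : {ffun 'I_n -> 'I_N}, L1 mu (zext (cube (grid_point a h k) h) f)) ->
  L1 mu (zext (cube a (N%:R * h)) f).
Proof.
move=> h0 N0 /choice[J HJ]; exists (\sum_k J k); exact: has_int_grid.
Qed.

Lemma card_ord_itv N p q : (q <= N)%N -> #|[pred j : 'I_N | (p <= j < q)%N]| = (q - p)%N.
Proof.
move=> qN; rewrite -sum1_card.
rewrite -(big_mkord (fun j => p <= j < q)%N (fun=> 1%N))/=.
rewrite -(big_nat_widen _ _ _ (fun j => p <= j)%N)//.
have /= <- := @big_nat_widenl _ 0%N addn p 0 q xpredT (fun=> 1%N) (leq0n p).
by rewrite sum_nat_const_nat muln1.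
Qed.

(** A unit cell with all indices in [[p, q)] stays between [a + p] and [a + q] in every coordinate
    and so misses [D]; only the other cells are charged. For [q <= p] the truncated [q - p] is [0],
    in accordance with the empty index range. *)
Lemma upper_le_shell a N p q D phi c : (0 < N)%N -> (q <= N)%N -> 0 <= c ->
  (forall k : {ffun 'I_n -> 'I_N}, upper_le mu (cube (grid_point a 1 k) 1) phi c) ->
  D `<=` cube a N%:R ->
  (forall x, D x -> exists i, x ord0 i < a ord0 i + p%:R \/ a ord0 i + q%:R < x ord0 i) ->
  upper_le mu D phi ((N%:R ^+ n - (q - p)%:R ^+ n) * c).
Proof.
move=> N0 qN c0 H DN Dpq.
(* Here [inner] denotes the interior cells, not the inner product. *)
pose inner : pred {ffun 'I_n -> 'I_N} := [pred k | k \in ffun_on [pred j : 'I_N | (p <= j < q)%N]].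
have card_inner : #|inner| = ((q - p) ^ n)%N.
  have := @card_ffun_on 'I_n 'I_N [pred j : 'I_N | (p <= j < q)%N].
  by rewrite card_ord_itv// card_ord => <-; apply: eq_card => k.
apply: upper_leS (@upper_le_grid a 1 N phi c (predC inner) _) _ _ _ => //.
- move=> x Dx; have [|k kx] := @grid_cover a 1 N x ltr01 N0.
    by rewrite mulr1; exact: DN.
  exists k => //=; apply/negP => /ffun_onP kin.
  have [j hj] := Dpq x Dx; have := kin j; rewrite inE => /andP[pk kq].
  move/cubeP: kx => /(_ j); rewrite !mxE mulr1.
  move: pk; rewrite -(ler_nat R) => pk; move: kq; rewrite -(ler_nat R) -natr1.
  lra.
- rewrite -!natrX; have := cardC inner; rewrite card_ffun !card_ord card_inner => <-.
  by rewrite ler_wpM2r// natrD addrAC subrr add0r.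
Qed.

End Grid.


(** * The character and asymptotics of cell counts *)

Section Character.
Variable R : realType.

Lemma norm_expmi (t : R) : complex.Re `|expmi t| = 1.
Proof.
rewrite /expmi normc_def /= !(mul0r, mul1r, mulr0, oppr0, subr0, addr0, add0r).
by rewrite sqrrN cos2Dsin2 sqrtr1.
Qed.

(** The squared distance of the two values is [2 (1 - cos (s - t))], so continuity of the cosine at
    [0] with tolerance [e ^+ 2 / 2] is enough. *)
Lemma expmi_uniform_continuous (e : R) : 0 < e -> exists2 d : R, 0 < d &
  forall s t, `|s - t| <= d -> complex.Re `|expmi s - expmi t| <= e.
Proof.
move=> e0; have e20 : 0 < e ^+ 2 / 2 by rewrite divr_gt0// exprn_gt0.
have /cvgrPdist_lt/(_ _ e20)/nbhs_ballP[d d0 hd] := @continuous_cos R 0.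
exists (d / 2); first by rewrite divr_gt0.
move=> s t st; have std : ball 0 d (s - t).
  rewrite -ball_normE/= sub0r normrN (le_lt_trans st)//.
  by rewrite ltr_pdivrMr// ltr_pMr// ltr1n.
have h : `|1 - (cos s * cos t + sin s * sin t)| < e ^+ 2 / 2.
  by have := hd _ std; rewrite /= cos0 cosB.
rewrite /expmi normc_def /= !(mul0r, mul1r, mulr0, oppr0, subr0, addr0, add0r).
rewrite -[leRHS]ger0_norm ?(ltW e0)// -sqrtr_sqr; apply: ler_wsqrtr.
have := ler_norm (1 - (cos s * cos t + sin s * sin t)).
by have := cos2Dsin2 s; have := cos2Dsin2 t; nra.
Qed.

(** After division by [T ^+ n] both bounds say that [(1 + b / T) ^+ n] and [(1 - b / T) ^+ n] are
    within [e] of [1], by continuity of the power. *)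
Lemma shifted_powers_asymptotic (n : nat) (b e : R) : 0 <= b -> 0 < e ->
  exists T0 : R, [/\ 0 < T0, b <= T0 & forall T, T0 <= T ->
    (T + b) ^+ n <= (1 + e) * T ^+ n /\ (1 - e) * T ^+ n <= (T - b) ^+ n].
Proof.
move=> b0 e0.
have : (fun y : R => (1 + y) ^+ n) @ 0 --> (1 + 0 : R) ^+ n.
  by apply: (@cvg_comp _ _ _ (fun y => 1 + y) (fun y => y ^+ n));
    [apply: cvgD; [exact: cvg_cst|exact: cvg_id]|exact: exprn_continuous].
rewrite addr0 expr1n => /cvgrPdist_lt/(_ _ e0)/nbhs_ballP[d d0 hd].
have d0' : 0 < d by [].
have bd0 : 0 <= b / d by rewrite divr_ge0// ltW.
(* The term [b / d] forces [b / T < d]; the rest gives [b <= T0] and positivity. *)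
exists (b / d + b + 1); split; [lra|lra|] => T hT.
have T0 : 0 < T by lra.
have bT : b / T < d.
  by rewrite ltr_pdivrMr// -ltr_pdivrMl// mulrC; lra.
have bT0 : 0 <= b / T by rewrite divr_ge0// ltW.
have Tn0 : 0 < T ^+ n by rewrite exprn_gt0.
have TE y : T + y = (1 + y / T) * T by rewrite mulrDl divfK ?gt_eqF// mul1r.
have near y : `|y| = b / T -> `|1 - (1 + y) ^+ n| < e.
  by move=> yb; apply: (hd y); rewrite -ball_normE/= sub0r normrN yb.
rewrite !TE !exprMn; split; rewrite ler_wpM2r ?(ltW Tn0)//.
  have := near (b / T) (ger0_norm bT0); rewrite ltr_norml; lra.
have := near (- b / T); rewrite mulNr normrN => /(_ (ger0_norm bT0)).
rewrite ltr_norml; lra.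
Qed.

(** In use, [u] and [v] are the sides of an outer and an inner cube of unit cells, so the left side
    is the cost of a boundary shell. *)
Lemma powers_gap_le (n : nat) (T b d M u v : R) : 0 <= M -> b <= T ->
  0 <= u -> u <= T + b -> T - b <= v ->
  (T + b) ^+ n <= (1 + d) * T ^+ n -> (1 - d) * T ^+ n <= (T - b) ^+ n ->
  (u ^+ n - v ^+ n) * M <= T ^+ n * (2 * d * M).
Proof.
move=> M0 bT u0 uT Tv h1 h2; rewrite mulrA ler_wpM2r//.
have hu : u ^+ n <= (T + b) ^+ n.
  by apply: lerXn2r; rewrite ?nnegrE// (le_trans u0).
have hv : (T - b) ^+ n <= v ^+ n.
  by apply: lerXn2r; rewrite ?nnegrE ?subr_ge0// (le_trans _ Tv)// subr_ge0.
lra.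
Qed.

(** The three terms are the errors of one comparison of integrals: the period error over [m.+1 ^ n]
    cells of side [l], and two boundary shells, one for each translation to the common upper
    corner. *)
Lemma counting_asymptotic (n p : nat) (l M e : R) : 0 < l -> 0 <= M -> 0 < e ->
  exists2 T0 : R, 0 < T0 & forall T, T0 <= T -> forall m q : nat,
    m%:R <= T / l -> q%:R <= T < q.+1%:R ->
    m.+1%:R ^+ n * (l ^+ n * (e / 2)) +
    ((q + 1 + p)%:R ^+ n - (q - p)%:R ^+ n) * M +
    ((q + 1 + p)%:R ^+ n - (q - p)%:R ^+ n) * M < T ^+ n * e.
Proof.
(* Each shell costs [2 d M] relative to [T ^+ n], so the total is at most [e / 2 + d (e / 2 + 4 M)];
   this [d] makes the last term smaller than [e / 2]. *)
move=> l0 M0 e0; pose d := e / 2 / (e / 2 + 4 * M + 1).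
have D0 : 0 < e / 2 + 4 * M + 1 by lra.
have d0 : 0 < d by rewrite !divr_gt0.
have dM : d * (e / 2 + 4 * M) < e / 2.
  by rewrite mulrAC ltr_pdivrMr// ltr_pM2l//; lra.
have p0 : 0 <= p%:R :> R by [].
(* One constant absorbs all rounding: [(m + 1) l <= T + l], [q + 1 + p <= T + 1 + p] and
   [T - 1 - p < q - p]. *)
have b0 : 0 <= l + 1 + p%:R by lra.
have [T0 [T00 bT0 hT]] := shifted_powers_asymptotic n b0 d0.
exists T0 => // T T0T m q m1 /andP[q1 q2].
have [hT1 hT2] := hT _ T0T.
have T_gt0 : 0 < T by exact: lt_le_trans T0T.
have {}m1 : m.+1%:R * l <= T + (l + 1 + p%:R).
  by move: m1; rewrite ler_pdivlMr// -natr1 mulrDl mul1r; lra.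
have u1 : (q + 1 + p)%:R <= T + (l + 1 + p%:R) by rewrite !natrD; lra.
have v1 : T - (l + 1 + p%:R) <= (q - p)%:R.
  have pq : (p <= q)%N.
    by rewrite -ltnS -(ltr_nat R); apply: le_lt_trans q2; lra.
  by rewrite natrB//; rewrite -natr1 in q2; lra.
have Tn0 : 0 < T ^+ n by rewrite exprn_gt0.
have E1 : m.+1%:R ^+ n * (l ^+ n * (e / 2)) <= (1 + d) * T ^+ n * (e / 2).
  rewrite mulrA -exprMn ler_wpM2r ?divr_ge0 ?(ltW e0)//; apply: le_trans hT1.
  apply: lerXn2r => //; rewrite nnegrE; first by rewrite mulr_ge0// ltW.
  by rewrite addr_ge0// ltW.
have E2 : ((q + 1 + p)%:R ^+ n - (q - p)%:R ^+ n) * M <= T ^+ n * (2 * d * M).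
  by apply: powers_gap_le u1 v1 hT1 hT2 => //; exact: le_trans T0T.
have E5 : T ^+ n * (d * (e / 2 + 4 * M)) < T ^+ n * (e / 2) by rewrite ltr_pM2l.
by move: E1 E2 E5; clear; lra.
Qed.

Lemma max_itv (x y p : R) : `|x - y| <= p -> x <= Num.max x y <= x + p.
Proof.
rewrite ler_norml => xyp; rewrite le_max lexx ge_max/=.
by apply/andP; split; lra.
Qed.

End Character.

(** * Integrals of the modulated function over cubes *)

Section BohrMean.
Variables (R : realType) (n : nat) (Y : completeNormedModType R[i]).
Variable mu : {measure set (Rn R n) -> \bar R}.
Hypothesis Hmu : is_lebesgue mu.
Variables (lambda : 'rV[R]_n) (Lambda : set 'rV[R]_n) (F : 'rV[R]_n -> Y).
Hypothesis HL0 : orthant n `<=` Lambda.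
Hypothesis HL2 : forall l : R, 0 < l ->
  forall a x, Lambda a -> Omega n x -> Lambda (a + l *: x).
Variable M : R.
Implicit Types (a b t v : 'rV[R]_n) (l : R).
Hypothesis M0 : 0 <= M.
Hypothesis F_int : forall t, Lambda t ->
  bochner_integrable mu (Omega n) (fun x => F (t + x)).
Hypothesis F_bound : forall t, Lambda t ->
  (L1norm mu (Omega n) (fun x => F (t + x)) <= M%:E)%E.

Let G (t : Rn R n) : Y := expmi (inner lambda t) *: F t.

Let ynormG t : ynorm (G t) = ynorm (F t).
Proof. by rewrite ynormZ norm_expmi mul1r. Qed.

(** [HL2] admits [l] times a point of the unit cube; [l = 1 + \sum_i v_i] is positive and dominates
    every coordinate of [v]. *)
Lemma Lambda_orthant a v : Lambda a -> orthant n v -> Lambda (a + v).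
Proof.
move=> La v0; pose l := 1 + \sum_i v ord0 i.
have l0 : 0 < l by rewrite ltr_wpDr// sumr_ge0.
rewrite (_ : v = l *: (l^-1 *: v)); last by rewrite scalerA divff ?gt_eqF// scale1r.
apply: HL2 => // i; rewrite !mxE mulr_ge0 ?invr_ge0 ?(ltW l0)// ?v0//=.
rewrite ler_pdivrMl// mulr1 /l (bigD1 i)//= addrCA lerDl.
by rewrite addr_ge0// sumr_ge0.
Qed.

Lemma Lambda_grid a h N (k : {ffun 'I_n -> 'I_N}) : 0 <= h -> Lambda a ->
  Lambda (grid_point a h k).
Proof.
move=> h0 La; rewrite (_ : grid_point a h k = a + \row_i ((k i)%:R * h)).
  by apply: Lambda_orthant => // i; rewrite mxE mulr_ge0.
by apply/rowP => i; rewrite !mxE.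
Qed.

Lemma upper_le_unit_cube t : Lambda t ->
  upper_le mu (cube t 1) (fun x => ynorm (F x)) M.
Proof.
move=> Lt; have := upper_le_L1norm (F_int Lt) (F_bound Lt).
move=> /(upper_le_comp (measurable_shift (- t)) (lebesgue_shift Hmu (- t))).
rewrite Omega_cube => U; apply: upper_leS U _ _ _ => //.
  by rewrite -[cube t 1](preimage_shift_cube (- t)) addNr.
by move=> x _; rewrite /= addrA subrr add0r.
Qed.

Lemma L1_unit_cube t : Lambda t -> L1 mu (zext (cube t 1) F).
Proof.
move=> /F_int[I /is_bochner_has_int hI]; exists I.
have := has_int_comp (measurable_shift (- t)) (lebesgue_shift Hmu (- t)) hI.
apply: has_int_ext => x; rewrite /zext /=.
rewrite addrA subrr add0r; congr (if _ then _ else _).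
apply: asbool_equiv_eq; rewrite Omega_cube.
by rewrite -[cube t 1](preimage_shift_cube (- t)) addNr.
Qed.

Lemma upper_le_grid_cell a N (k : {ffun 'I_n -> 'I_N}) : Lambda a ->
  upper_le mu (cube (grid_point a 1 k) 1) (fun x => ynorm (F x)) M.
Proof. by move=> La; apply/upper_le_unit_cube/Lambda_grid. Qed.

Lemma cubeS a (l l' : R) : l <= l' -> cube a l `<=` cube a l'.
Proof. by move=> ll x /cubeP h; apply/cubeP => i; have := h i; lra. Qed.

Lemma ex_nat_ge (x : R) : exists2 N : nat, (0 < N)%N & x <= N%:R.
Proof.
exists (Num.bound `|x|).+1 => //; apply: le_trans (ler_norm _) _.
by apply: le_trans (ltW (archi_boundP (normr_ge0 _))) _; rewrite ler_nat.
Qed.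

Lemma L1_cube a l : Lambda a -> L1 mu (zext (cube a l) F).
Proof.
move=> La; have [N N0 lN] := ex_nat_ge l.
apply: (@L1_zextS _ _ _ _ _ _ (cube a (N%:R * 1))).
- exact: measurable_cube.
- by apply: cubeS; rewrite mulr1.
- by apply: L1_grid => // k; apply/L1_unit_cube/Lambda_grid.
Qed.

Lemma upper_le_cube_F a l : Lambda a ->
  exists c, upper_le mu (cube a l) (fun x => ynorm (F x)) c.
Proof.
move=> La; have [N N0 lN] := ex_nat_ge l.
exists ((N ^ n)%:R * M).
apply: upper_leS (@upper_le_cube _ _ _ a 1 N _ M _ N0 _) _ _ _ => //.
- by move=> k; exact: upper_le_grid_cell.
- by apply: cubeS; rewrite mulr1.
- by [].

Qed.

(** All nonzero summands are the same vector, so the triangle inequality is an equality. This turns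
    a bound on the norm of a sum of restrictions of [F] to cells into a bound on the sum of their
    norms. *)
Lemma ynorm_sum_ind (K : finType) (b : pred K) (v : Y) :
  ynorm (\sum_(k : K) if b k then v else 0) = \sum_(k : K) if b k then ynorm v else 0.
Proof.
rewrite -!big_mkcond !sumr_const; elim: #|_| => [|m ih].
  by rewrite !mulr0n ynorm0.
apply: complexI; rewrite -ynormE -scaler_nat normrZ normr_nat ynormE.
by rewrite -[in RHS]mulr_natl rmorphM rmorph_nat.
Qed.

(* [G] is approximated by [x |-> expmi (inner lambda a_k) *: F x] on the cells
   of a fine grid with corners [a_k]. *)
Lemma L1_cube_modulated a l : 0 < l -> Lambda a -> L1 mu (zext (cube a l) G).
Proof.
move=> l0 La; have [c Fc] := upper_le_cube_F l La.
have c0 := upper_le_ge0 Fc.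
apply: L1_approx => e e0.
(* On a cell of side [h] the phase varies by at most [A * h <= d], hence the character by at most
   [e / (c + 1)]; weighted by the bound [c] on the integral of the norm of [F], this is at most [e].
   The [+ 1] covers [c = 0]. *)
have [|d d0 hd] := @expmi_uniform_continuous R (e / (c + 1)).
  by rewrite divr_gt0// ltr_wpDl.
pose A := \sum_i `|lambda ord0 i|.
have A0 : 0 <= A by rewrite sumr_ge0.
have [N N0 hN] := ex_nat_ge (l * A / d).
have NR : 0 < N%:R :> R by rewrite ltr0n.
pose h := l / N%:R; have h0 : 0 < h by rewrite divr_gt0.
have hl : N%:R * h = l by rewrite mulrC divfK// gt_eqF.
have hA : A * h <= d.
  by move: hN; rewrite ler_pdivrMr// /h mulrA ler_pdivrMr// mulrC [d * _]mulrC.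
pose C (k : {ffun 'I_n -> 'I_N}) := cube (grid_point a h k) h.
pose z (k : {ffun 'I_n -> 'I_N}) := expmi (inner lambda (grid_point a h k)).
exists (fun x => \sum_k z k *: zext (C k) F x); split.
  have /choice[J HJ] (k : {ffun 'I_n -> 'I_N}) : L1 mu (zext (C k) F).
    by apply: L1_cube; apply: Lambda_grid => //; exact: ltW.
  by exists (\sum_k z k *: J k); apply: has_int_sum => k _; exact: has_intZ.
have GU := grid_zext Hmu a G h0 N0; have FU := grid_zext Hmu a F h0 N0.
rewrite hl in GU FU.
pose W x := \sum_k (zext (C k) G x - z k *: zext (C k) F x).
suff WU : upper_le mu setT (fun x => ynorm (W x)) e.
  rewrite -[e]add0r; apply: L1_le_ext (L1_leD (L1_leN GU) WU) => x.
  by rewrite /W sumrB opprB addrA subrK.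
have FS : upper_le mu setT (fun x => ynorm (\sum_k zext (C k) F x)) c.
  have {}Fc : upper_le mu setT (fun x => ynorm (zext (cube a l) F x)) c.
    exact: (@L1_le_zext _ (Rn R n) R Y mu F (cube a l) c).1 Fc.
  rewrite -[c]add0r; apply: L1_le_ext (L1_leD FU Fc) => x.
  by rewrite subrK.
have ec : 0 <= e / (c + 1) by rewrite divr_ge0// ?addr_ge0// ltW.
apply: upper_leS (upper_leZ ec FS) _ _ _ => //; last first.
  by rewrite mulrAC ler_pdivrMr ?ltr_wpDl//; nra.
move=> x _; rewrite /W ynorm_sum_ind mulr_sumr.
apply: le_trans (ynorm_sum _ _ _) _; apply: ler_sum => k _.
have [kx|kx] := pselect (C k x); last first.
  by rewrite !zextF// scaler0 subr0 ynorm0 asboolF// mulr0.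
rewrite !zextT// asboolT// /G -scalerBl ynormZ ler_wpM2r ?ynorm_ge0//.
apply: hd; apply: le_trans hA; rewrite /inner -sumrB mulr_suml.
apply: le_trans (ler_norm_sum _ _ _) _; apply: ler_sum => i _.
rewrite -mulrBr normrM ler_wpM2l// ler_norml.
by have := (cubeP _ _ _).1 kx i; lra.
Qed.

Definition bohr_int a l := bint mu (cube a l) G.

Lemma bohr_intP a l : 0 < l -> Lambda a ->
  has_int mu (zext (cube a l) G) (bohr_int a l).
Proof.
move=> l0 La; apply: bint_has_int; first exact: measurable_cube.
exact: L1_cube_modulated.
Qed.

(* Only the cells meeting the symmetric difference of the two cubes contribute. *)
Lemma bohr_int_shell a b b' l l' N p q : 0 < l -> 0 < l' ->
  Lambda a -> Lambda b -> Lambda b' -> (0 < N)%N -> (q <= N)%N ->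
  cube b l `<=` cube a N%:R -> cube b' l' `<=` cube a N%:R ->
  (forall x : 'rV[R]_n, (forall i, a ord0 i + p%:R <= x ord0 i <= a ord0 i + q%:R) ->
     cube b l x /\ cube b' l' x) ->
  ynorm (bohr_int b l - bohr_int b' l') <= (N%:R ^+ n - (q - p)%:R ^+ n) * M.
Proof.
move=> l0 l'0 La Lb Lb' N0 qN bN b'N inn.
apply: has_int_norm (has_intB (bohr_intP l0 Lb) (bohr_intP l'0 Lb')) _.
pose D : set (Rn R n) := (cube b l `|` cube b' l') `\` (cube b l `&` cube b' l').
have : upper_le mu D (fun x => ynorm (F x)) ((N%:R ^+ n - (q - p)%:R ^+ n) * M).
  apply: (upper_le_shell (a := a)) => //.
  - by move=> k; exact: upper_le_grid_cell.
  - by move=> x [[/bN|/b'N]].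
  - move=> x [_ Dx]; apply: contrapT => /forallNP h; apply: Dx; apply: inn => i.
    by have /not_orP[/negP ap /negP aq] := h i; rewrite leNgt ap leNgt aq.
move=> [g [mg g0 Fg ig]]; exists g; split=> // x _.
have [Dx|Dx] := pselect (D x).
  apply: le_trans (Fg _ Dx); rewrite lee_fin.
  have [bx|bx] := pselect (cube b l x); have [b'x|b'x] := pselect (cube b' l' x).
  - by rewrite !zextT// subrr ynorm0 ynorm_ge0.
  - by rewrite zextT// zextF// subr0 ynormG.
  - by rewrite zextF// zextT// sub0r ynormN ynormG.
  - by rewrite !zextF// subrr ynorm0 ynorm_ge0.
suff -> : zext (cube b l) G x - zext (cube b' l') G x = 0 by rewrite ynorm0.
have [bx|bx] := pselect (cube b l x); have [b'x|b'x] := pselect (cube b' l' x).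
- by rewrite !zextT// subrr.
- by exfalso; apply: Dx; split; [left|case].
- by exfalso; apply: Dx; split; [right|case].
- by rewrite !zextF// subrr.
Qed.

(** With [q] the integer part of [l], both cubes lie in the cube of side [q + 1 + p] at [a], and
    both contain all points between [a + p] and [a + q]. *)
Lemma bohr_int_translate a b l p q : 0 < l -> Lambda a ->
  (forall i, a ord0 i <= b ord0 i <= a ord0 i + p%:R) -> q%:R <= l < q.+1%:R ->
  ynorm (bohr_int a l - bohr_int b l) <= ((q + 1 + p)%:R ^+ n - (q - p)%:R ^+ n) * M.
Proof.
move=> l0 La ab /andP[ql lq].
have Lb : Lambda b.
  rewrite (_ : b = a + (b - a)); last by rewrite addrC subrK.
  by apply: Lambda_orthant => // i; rewrite !mxE; have := ab i; lra.
have p0 : 0 <= p%:R :> R by [].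
apply: (bohr_int_shell (a := a)) => //.
- by rewrite addn1.
- by rewrite -addnA leq_addr.
- by apply: cubeS; rewrite natrD addn1; lra.
- move=> x /cubeP h; apply/cubeP => i; have := h i; have := ab i.
  by rewrite natrD addn1; lra.
- by move=> x h; split; apply/cubeP => i; have := h i; have := ab i; lra.
Qed.

Lemma Lambda0 : Lambda 0.
Proof. by apply: HL0 => i; rewrite mxE. Qed.

(** Translation by [t] moves both integrals to the cube at [0]. The norm of the difference is then
    bounded over the larger cube of side [N * l], whose cells have their corners in [Lambda], where
    [H] applies. *)
Lemma bohr_int_period t l c N T : 0 < l -> 0 < T -> (0 < N)%N -> T <= N%:R * l ->
  Lambda t ->
  (forall u, Lambda u ->
     upper_le mu (cube u l) (fun x => ynorm (G (t + x) - G x)) c) ->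
  ynorm (bohr_int 0 T - bohr_int t T) <= N%:R ^+ n * c.
Proof.
move=> l0 T0 N0 TN Lt H.
have hT : has_int mu (zext (cube 0 T) (fun x => G (t + x))) (bohr_int t T).
  have := has_int_comp (measurable_shift t) (lebesgue_shift Hmu t) (bohr_intP T0 Lt).
  apply: has_int_ext => x; rewrite /zext /=; congr (if _ then _ else _).
  apply: asbool_equiv_eq; have E := @preimage_shift_cube R n t 0 T.
  by rewrite addr0 in E; rewrite -E.
rewrite ynormB; apply: has_int_norm (has_intB hT (bohr_intP T0 Lambda0)) _.
have U : upper_le mu (cube 0 (N%:R * l)) (fun x => ynorm (G (t + x) - G x)) (N%:R ^+ n * c).
  rewrite -natrX; apply: upper_le_cube => // k.
  by apply/H/Lambda_grid; [exact: ltW|exact: Lambda0].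
have {}U : upper_le mu (cube 0 T) (fun x => ynorm (G (t + x) - G x)) (N%:R ^+ n * c).
  by apply: upper_leS U _ _ _ => //; exact: cubeS.
have := (@L1_le_zext _ (Rn R n) R Y mu (fun x => G (t + x) - G x) (cube 0 T) _).1 U.
apply: L1_le_ext => x; have [Qx|Qx] := pselect (cube 0 T x); first by rewrite !zextT.
by rewrite !zextF// subrr.
Qed.

Lemma ex_nat_floor (x : R) : 0 <= x -> exists q : nat, q%:R <= x < q.+1%:R.
Proof. by move=> x0; exists (Num.truncn x); exact: truncn_itv. Qed.

(** * Uniform closeness and convergence of the means *)

Hypothesis G_ap : eW1ap mu Lambda G.

Lemma bohr_int_uniform (e : R) : 0 < e -> exists2 T0, 0 < T0 &
  forall T, T0 <= T -> forall s, orthant n s ->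
  ynorm (bohr_int 0 T - bohr_int s T) < T ^+ n * e.
Proof.
move=> e0; have e20 : 0 < e / 2 by rewrite divr_gt0.
have [l [L [l0 [L0 HG]]]] := G_ap e20.
have [p p0 Lp] := ex_nat_ge L.
have [T0 T00 hT] := counting_asymptotic n p l0 M0 e0.
exists T0 => // T T0T s os.
have T_gt0 : 0 < T by exact: lt_le_trans T0T.
have Ls := HL0 os.
have [t [ts [Lt [c [ce Hc]]]]] := HG s Ls.
have tsL i : `|t ord0 i - s ord0 i| < L.
  apply: le_lt_trans ts; rewrite /enorm /inner -sqrtr_sqr; apply: ler_wsqrtr.
  rewrite (bigD1 i)//= !mxE -expr2 lerDl sumr_ge0// => j _.
  by rewrite -expr2 sqr_ge0.
(* Undoing the factor [l ^- n] gives a bound for one cube of side [l]. Only half of [e] is spent on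
   periods; the other half is left for the boundary shells. *)
have Hc' u : Lambda u ->
    upper_le mu (cube u l) (fun x => ynorm (G (t + x) - G x)) (l ^+ n * (e / 2)).
  move=> /Hc [BI]; rewrite shift_scale_Omega// in BI * => hc.
  apply: upper_le_L1norm => //.
  have ln0 : 0 < l ^+ n by rewrite exprn_gt0.
  move: hc; rewrite lee_pdivrMl// => /le_trans; apply.
  by rewrite -EFinM lee_fin ler_wpM2l// ltW.
have [m /andP[m1 m2]] := @ex_nat_floor (T / l) (ltW (divr_gt0 T_gt0 l0)).
have [q qT] := @ex_nat_floor T (ltW T_gt0).
have mT : T <= m.+1%:R * l by rewrite -ler_pdivrMr// ltW.
have P1 := bohr_int_period l0 T_gt0 (ltn0Sn m) mT Lt Hc'.
pose w := \row_i Num.max (t ord0 i) (s ord0 i) : 'rV[R]_n.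
have P2 := @bohr_int_translate t w T p q T_gt0 Lt _ qT.
have P3 := @bohr_int_translate s w T p q T_gt0 Ls _ qT.
have {}P2 : ynorm (bohr_int t T - bohr_int w T) <=
    ((q + 1 + p)%:R ^+ n - (q - p)%:R ^+ n) * M.
  by apply: P2 => i; rewrite mxE max_itv// (le_trans (ltW (tsL i))).
have {}P3 : ynorm (bohr_int s T - bohr_int w T) <=
    ((q + 1 + p)%:R ^+ n - (q - p)%:R ^+ n) * M.
  by apply: P3 => i; rewrite mxE maxC max_itv// distrC (le_trans (ltW (tsL i))).
rewrite ynormB in P3.
apply: le_lt_trans (ynormB_le3 P1 P2 P3) _.
exact: hT T0T m q m1 qT.
Qed.

(* The cube of side [N l] splits into [N ^ n] cubes of side [l], whose means
   are all close to the mean over the first one. *)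
Lemma bohr_int_multiple (e : R) l N : 0 < l -> (0 < N)%N ->
  (forall s, orthant n s -> ynorm (bohr_int 0 l - bohr_int s l) <= l ^+ n * e) ->
  ynorm (bohr_int 0 (N%:R * l) - (N%:R ^+ n)%:C *: bohr_int 0 l) <= (N%:R * l) ^+ n * e.
Proof.
move=> l0 N0 H.
have grid_orthant (k : {ffun 'I_n -> 'I_N}) : orthant n (grid_point 0 l k).
  by move=> i; rewrite !mxE add0r mulr_ge0// ltW.
have -> : bohr_int 0 (N%:R * l) =
    \sum_(k : {ffun 'I_n -> 'I_N}) bohr_int (grid_point 0 l k) l.
  apply: has_int_uniq (bohr_intP _ Lambda0) _; first by rewrite mulr_gt0// ltr0n.
  by apply: has_int_grid => // k; apply: bohr_intP => //; exact/HL0.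
have -> : (N%:R ^+ n)%:C *: bohr_int 0 l = \sum_(k : {ffun 'I_n -> 'I_N}) bohr_int 0 l.
  by rewrite sumr_const card_ffun !card_ord -natrX rmorph_nat scaler_nat.
rewrite -sumrB; apply: le_trans (ynorm_sum _ _ _) _.
rewrite exprMn -mulrA -natrX mulr_natl.
have -> : (N ^ n)%N = #|{ffun 'I_n -> 'I_N}| by rewrite card_ffun !card_ord.
by rewrite -sumr_const; apply: ler_sum => k _; rewrite ynormB; exact: H.
Qed.

Definition bohr_mean a l : Y := (l ^- n)%:C *: bohr_int a l.

Lemma bohr_meanK a l : 0 < l -> (l ^+ n)%:C *: bohr_mean a l = bohr_int a l.
Proof.
move=> l0; rewrite /bohr_mean scalerA -rmorphM divff ?rmorph1 ?scale1r//.
by rewrite expf_neq0// gt_eqF.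
Qed.

Lemma ynorm_bohr_mean a l (v : Y) : 0 < l ->
  ynorm (bohr_mean a l - v) = l ^- n * ynorm (bohr_int a l - (l ^+ n)%:C *: v).
Proof.
move=> l0; have ln0 : 0 < l ^+ n by rewrite exprn_gt0.
rewrite -(bohr_meanK a l0) -scalerBr ynormZr ger0_norm ?ltW// mulrA mulVf ?mul1r//.
by rewrite gt_eqF.
Qed.

Lemma bohr_mean_uniform (e : R) : 0 < e -> exists2 T0, 0 < T0 & forall T, T0 <= T ->
  forall s, orthant n s ->
  ynorm (bohr_mean 0 T - bohr_mean s T) < e.
Proof.
move=> /bohr_int_uniform[T0 T00 H]; exists T0 => // T T0T s os.
have T_gt0 : 0 < T by exact: lt_le_trans T0T.
rewrite ynorm_bohr_mean// bohr_meanK// ltr_pdivrMl ?exprn_gt0//.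
exact: H.
Qed.

(** A large [T] need not be a multiple of [l], so it is rounded down to [W = N * l]. Three errors
    result: the shell between the cubes of sides [T] and [W], the tiling error for [W], and the
    replacement of [W ^+ n] by [T ^+ n] in front of [m]. *)
Lemma bohr_mean_cauchy (e : R) : 0 < e -> exists m : Y, exists2 T0 : R, 0 < T0 &
  forall T, T0 <= T -> ynorm (m - bohr_mean 0 T) < e.
Proof.
move=> e0; have e20 : 0 < e / 2 by rewrite divr_gt0.
have [l l0 Hl] := bohr_int_uniform e20.
pose m := bohr_mean 0 l; exists m; have m0 := ynorm_ge0 m.
(* Relative to [T ^+ n] the shell costs [2 d M] and the change of normalisation [d * ynorm m];
   together they stay below [e / 2], and the tiling error takes the other half. *)
pose d := e / 2 / (2 * M + ynorm m + 1).
have D0 : 0 < 2 * M + ynorm m + 1 by have := M0; lra.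
have d0 : 0 < d by rewrite divr_gt0.
have dM : d * (2 * M + ynorm m) < e / 2.
  by rewrite mulrAC ltr_pdivrMr// ltr_pM2l//; lra.
(* Rounding [T] down to [W] loses less than [l], and passing to whole unit cells at most [1]
   more. *)
have b0 : 0 <= l + 1 by rewrite addr_ge0// ltW.
have [T0 [T00 bT0 hT]] := shifted_powers_asymptotic n b0 d0.
exists T0 => // T T0T.
have T_gt0 : 0 < T by exact: lt_le_trans T0T.
have lT : l <= T by lra.
have [N /andP[N1 N2]] := @ex_nat_floor (T / l) (ltW (divr_gt0 T_gt0 l0)).
have N0 : (0 < N)%N.
  rewrite -ltnS -(ltr_nat R); apply: le_lt_trans N2.
  by rewrite ler_pdivlMr// mul1r.
pose W := N%:R * l.
have W0 : 0 < W by rewrite mulr_gt0// ltr0n.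
have WT : W <= T by rewrite -ler_pdivlMr.
have TW : T < W + l by rewrite -[X in _ + X]mul1r -mulrDl natr1 -ltr_pdivrMr.
have [q1 /andP[q11 q12]] := @ex_nat_floor T (ltW T_gt0).
have [q2 /andP[q21 q22]] := @ex_nat_floor W (ltW W0).
have q21le : (q2 <= q1.+1)%N.
  by rewrite -(ler_nat R) ltW//; apply: le_lt_trans q12; apply: le_trans WT.
have P1 : ynorm (bohr_int 0 T - bohr_int 0 W) <= (q1.+1%:R ^+ n - (q2 - 0)%:R ^+ n) * M.
  apply: (@bohr_int_shell 0 0 0 T W q1.+1 0%N q2) => //; try exact: Lambda0.
  - by apply: cubeS; exact: ltW.
  - by apply: cubeS; apply: le_trans WT _; exact: ltW.
  - by move=> x h; split; apply/cubeP => i; have := h i; rewrite !mxE; lra.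
rewrite subn0 in P1.
have P2 := @bohr_int_multiple (e / 2) l N l0 N0 (fun s os => ltW (Hl l (lexx l) s os)).
rewrite -(bohr_meanK 0 l0) scalerA -rmorphM -exprMn -/W -/m in P2.
have [hT1 hT2] := hT _ T0T.
have Tn0 : 0 < T ^+ n by rewrite exprn_gt0.
have E1 : (q1.+1%:R ^+ n - q2%:R ^+ n) * M <= T ^+ n * (2 * d * M).
  apply: powers_gap_le hT1 hT2 => //; first exact: le_trans T0T.
    by rewrite -natr1; clear P1 P2; lra.
  by rewrite -natr1 in q22; clear P1 P2; lra.
have WnT : W ^+ n <= T ^+ n by apply: lerXn2r; rewrite ?nnegrE ?(ltW W0) ?(ltW T_gt0).
have E4 : (1 - d) * T ^+ n <= W ^+ n.
  apply: (le_trans hT2); apply: lerXn2r; rewrite ?nnegrE ?(ltW W0)//.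
    by rewrite subr_ge0 (le_trans bT0).
  by clear P1 P2; lra.
have P3 : ynorm ((W ^+ n)%:C *: m - (T ^+ n)%:C *: m) <= T ^+ n * (d * ynorm m).
  rewrite -scalerBl -rmorphB ynormZr mulrA ler_wpM2r// distrC ger0_norm ?subr_ge0//.
  by clear P1 P2; lra.
rewrite ynormB ynorm_bohr_mean// ltr_pdivrMl//.
have E6 : T ^+ n * (d * (2 * M + ynorm m)) < T ^+ n * (e / 2) by rewrite ltr_pM2l.
have E7 : W ^+ n * (e / 2) <= T ^+ n * (e / 2) by rewrite ler_pM2r.
apply: le_lt_trans (ynormB_le3 P1 P2 P3) _.
by clear P1 P2 P3; lra.
Qed.

(** Completeness gives the limit for the corner [0]; the uniform closeness of the means carries the
    same limit to every other corner. *)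
Lemma bohr_mean_cvg : exists P : Y, forall s, orthant n s -> bohr_mean s @ +oo --> P.
Proof.
have near_ge (T0 : R) : \forall T \near +oo, T0 <= T.
  exact: nbhs_pinfty_ge (num_real _).
have [|P hP] := @ynorm_cauchy_ex _ _ _ (+oo)%R _ (bohr_mean 0).
  move=> e /bohr_mean_cauchy[m [T0 T00 H]]; exists m.
  by apply: filterS (near_ge T0) => T; exact: H.
exists P => s os; apply/cvg_ynormP => e e0.
have e20 : 0 < e / 2 by rewrite divr_gt0.
have [T0 T00 H] := bohr_mean_uniform e20.
have {}hP : \forall T \near +oo, ynorm (P - bohr_mean 0 T) < e / 2.
  exact: (cvg_ynormP _ _).1 hP _ e20.
move: (near_ge T0) hP; apply: filterS2 => T T0T PT.
apply: le_lt_trans (ynormB_le (bohr_mean 0 T) _ _) _.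
by rewrite [e]splitr; exact: ltrD PT (H _ T0T _ os).
Qed.

End BohrMean.

Theorem theorem3p21 (R : realType) (n : nat) (Y : completeNormedModType R[i])
  (mu : {measure set (Rn R n) -> \bar R}) (Hmu : is_lebesgue mu)
  (lambda : 'rV[R]_n) (Lambda : set 'rV[R]_n)
  (HL0 : orthant n `<=` Lambda)
  (HL1 : forall l : R, 0 < l ->
     forall a b x, Lambda a -> Lambda b -> Omega n x -> Lambda (a + b + l *: x))
  (HL2 : forall l : R, 0 < l ->
     forall a x, Lambda a -> Omega n x -> Lambda (a + l *: x))
  (F : 'rV[R]_n -> Y)
  (HF : stepanov_bounded mu Lambda F)
  (HFl : eW1ap mu Lambda (fun t => expmi (inner lambda t) *: F t)) :
  let mean := fun (s : 'rV[R]_n) (T : R) =>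
    (T ^- n)%:C *: bint mu (shift_scale s T (Omega n))
                        (fun t => expmi (inner lambda t) *: F t) in
  (exists P : Y, forall s, orthant n s -> mean s @ +oo --> P) /\
  (forall eps : R, 0 < eps -> exists T0 : R, 0 < T0 /\
     forall T : R, T0 <= T -> forall s, orthant n s ->
       ynorm (mean 0 T - mean s T) < eps).
Proof.
have [F_int [M F_bound]] := HF; move=> mean.
(* The maximum with [0] supplies the sign of the bound at once. *)
have M0 : 0 <= Num.max M 0 by rewrite le_max lexx orbT.
have {}F_bound t : Lambda t ->
    (L1norm mu (Omega n) (fun x => F (t + x)%R) <= (Num.max M 0)%:E)%E.
  by move=> /F_bound/le_trans; apply; rewrite lee_fin le_max lexx.
(* The scaled copy of [Omega] is rewritten as a cube for [T > 0], which holds eventually at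
   [+oo]. *)
have meanE s T : 0 < T -> mean s T = bohr_mean mu lambda F s T.
  by move=> T0; rewrite /mean shift_scale_Omega.
split.
  have [P HP] := bohr_mean_cvg Hmu HL0 HL2 M0 F_int F_bound HFl.
  exists P => s /HP; apply: cvg_trans; apply: near_eq_cvg.
  apply: filterS (nbhs_pinfty_gt (num_real 0)) => T T0.
  by rewrite meanE.
move=> e /(bohr_mean_uniform Hmu HL0 HL2 M0 F_int F_bound HFl)[T0 T00 H].
exists T0; split=> // T T0T s os.
by rewrite !meanE ?(lt_le_trans T00)//; exact: H.
Qed.
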